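(* Assume $r>0$ and, for $0\le n\le N$, $m\ge1$, define $y^{[m]*}_n:=\inf\{x\ge1:x\ge h^{[m]}_n(x)\}$. Then: (i) $y^{[m]*}_n$ is well defined and finite, and the exercise region is the upper interval $\bar D^{[m]}_{R,n}:=\{x\ge1:x\ge h^{[m]}_n(x)\}=[y^{[m]*}_n,\infty)$. (ii) $y^{[m+1]*}_n\le y^{[m]*}_n$. (iii) If $\pi_0\le\pi_1\le\dots\le\pi_{N-1}$, then $1=y^{[m]*}_0\le y^{[m]*}_1\le\dots\le y^{[m]*}_N$. (iv) With $\min\emptyset:=\partial$, let $$\sigma^*_m=\min\{\nu\in\{0,\dots,N\}:X_\nu\ge y^{[m]*}_{N-\nu}\},\quad\sigma^*_i=\min\{\nu\in\{0,\dots,N\}:\nu>\sigma^*_{i+1},\ X_\nu\ge y^{[i]*}_{N-\nu}\},\ i=m-1,\dots,1.$$ This schedule is optimal (attains the supremum) for $$\sup_{\vec\sigma\in\mathcal T^{[m]}_0}\mathrm E\Big[\sum_{i:\,\sigma_i\le N}\alpha^{\sigma_i}\mathbf 1_{\{\sigma_i\le\widetilde N\}}M_{\sigma_i}\Big];$$ an exercise pays only on $\{\sigma^*_i\le\widetilde N\}$, and if random maturity occurs before the next scheduled exercise, all remaining rights expire.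
   Context: Let $r\ge0$, $\alpha:=(1+r)^{-1}$, and $\lambda>1$ with $\lambda^{-1}<1+r<\lambda$. Put $p:=\frac{(1+r)-\lambda^{-1}}{\lambda-\lambda^{-1}}$, $q:=1-p$ (both in $(0,1)$). Let $N$ be a finite horizon, $S_0=s_0>0$ a constant and $S_\nu=s_0\lambda^{\varepsilon_1+\dots+\varepsilon_\nu}$ ($0\le\nu\le N$), where under $\mathrm P$ the $\varepsilon_\nu$ are i.i.d. with $\mathrm P(\varepsilon_\nu=1)=p$, $\mathrm P(\varepsilon_\nu=-1)=q$; $(\mathcal F_\nu)_{\nu=0}^N$ is the natural filtration of $S$. Let $m_0\ge s_0$, $M_\nu:=(\max_{0\le i\le\nu}S_i)\vee m_0$ and $X_\nu:=M_\nu/S_\nu\ge1$. Random maturity: $\widetilde N$ is a random variable with values in $\{0,\dots,N\}$, independent of the price process under $\mathrm P$, with $\mathrm P(\widetilde N=N)>0$; the contract is void from time $\widetilde N+1$ on. For $1\le n\le N$, $\pi_{n-1}:=\mathrm P(\widetilde N\ge N-n+1\mid\widetilde N\ge N-n)$. Put $\widetilde p:=\alpha\lambda p$, $\widetilde q:=\alpha\lambda^{-1}q$ (so $\widetilde p+\widetilde q=1$), $(\mathcal B\varphi)(x):=\widetilde p\,\varphi((\lambda^{-1}x)\vee1)+\widetilde q\,\varphi(\lambda x)$ for functions $\varphi$ on $[1,\infty)$, and $\mathcal B_n:=\pi_{n-1}\mathcal B$. With $g(x):=x$, define on $[1,\infty)$: $U^{[0]}_n\equiv0$, $U^{[m]}_0=g$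 ($m\ge1$), and for $1\le n\le N$, $m\ge1$, $$U^{[m]}_n(x)=\max\{g(x)+(\mathcal B_nU^{[m-1]}_{n-1})(x),\ (\mathcal B_nU^{[m]}_{n-1})(x)\}.$$ Put $\Delta U^{[m]}_n:=U^{[m]}_n-U^{[m-1]}_n$, $h^{[m]}_n:=\mathcal B_n\Delta U^{[m]}_{n-1}$ ($n\ge1$), $h^{[m]}_0:=0$. Admissible exercise vectors: let $\partial:=+\infty$ denote non-exercise. $\mathcal T^{[m]}_0$ is the set of vectors $(\sigma_m,\dots,\sigma_1)$ of $(\mathcal F_\nu)$-stopping times (price filtration only) with values in $\{0,\dots,N\}\cup\{\partial\}$ such that, pathwise, for some $\ell\in\{0,\dots,m\}$ (possibly depending on $\omega$) the finite coordinates are exactly $\sigma_m,\dots,\sigma_{m-\ell+1}$, with $0\le\sigma_m<\sigma_{m-1}<\dots<\sigma_{m-\ell+1}\le N$, and the remaining coordinates equal $\partial$. *)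

(* Defs.v *)
From mathcomp Require Import all_boot all_order all_algebra.
From mathcomp Require Import all_classical all_reals all_analysis.

Set Implicit Arguments.
Unset Strict Implicit.
Unset Printing Implicit Defensive.

Import Order.TTheory GRing.Theory Num.Theory.
Import numFieldNormedType.Exports.

Local Open Scope classical_set_scope.
Local Open Scope ring_scope.

Section binomial_parameters.
Context {R : realType}.
Implicit Types r lam : R.

Definition discount r : R := (1 + r)^-1.

Definition up_prob r lam : R := ((1 + r) - lam^-1) / (lam - lam^-1).

Definition down_prob r lam : R := 1 - up_prob r lam.

Definition tilted_up_prob r lam : R := discount r * lam * up_prob r lam.

Definition tilted_down_prob r lam : R := discount r * lam^-1 * down_prob r lam.

End binomial_parameters.

Section dynamic_programming.
Context {R : realType}.
Implicit Types (r lam x : R) (pi : nat -> R) (phi : R -> R) (m n : nat).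

(* Functions on [1, +oo[ are represented by total functions on R: for
   x >= 1 and lam > 1, Bop only evaluates phi at points of [1, +oo[. *)
Definition Bop r lam phi x : R :=
  tilted_up_prob r lam * phi (Num.max (lam^-1 * x) 1)
  + tilted_down_prob r lam * phi (lam * x).

(* pi k stands for pi_k, so the n-th operator (n >= 1) uses pi_(n-1). *)
Definition Bop_at r lam pi n phi x : R := pi n.-1 * Bop r lam phi x.

(* value r lam pi m n is U^[m]_n: m rights left, n periods to the horizon. *)
Fixpoint value r lam pi m n {struct n} : R -> R := fun x =>
  match m, n with
  | 0%N, _ => 0
  | _.+1, 0%N => x
  | m'.+1, n'.+1 =>
      Num.max (x + Bop_at r lam pi n (value r lam pi m' n') x)
              (Bop_at r lam pi n (value r lam pi m n') x)
  end.

Definition marginal_value r lam pi m n x : R :=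
  value r lam pi m n x - value r lam pi m.-1 n x.

(* h^[m]_n *)
Definition marginal_continuation r lam pi m n x : R :=
  if n is n'.+1 then Bop_at r lam pi n (marginal_value r lam pi m n') x else 0.

Definition exercise_region r lam pi m n : set R :=
  [set x | 1 <= x /\ marginal_continuation r lam pi m n x <= x].

(* y^[m]*_n; the real-valued inf has the value 0 on sets without infimum, so
   "well defined and finite" is has_inf (exercise_region r lam pi m n). *)
Definition boundary r lam pi m n : R := inf (exercise_region r lam pi m n).

End dynamic_programming.

Section price_process.
Context {R : realType} {T : Type}.
Implicit Types (lam : R) (eps : nat -> T -> R) (nu : nat).

Definition price lam (s0 : R) eps nu (w : T) : R :=
  s0 * lam `^ (\sum_(1 <= i < nu.+1) eps i w).

Definition running_max lam (s0 m0 : R) eps nu (w : T) : R :=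
  \big[Num.max/m0]_(0 <= i < nu.+1) price lam s0 eps i w.

Definition max_ratio lam (s0 m0 : R) eps nu (w : T) : R :=
  running_max lam s0 m0 eps nu w / price lam s0 eps nu w.

End price_process.

Section probabilistic_notions.
Context {d : measure_display} {T : measurableType d} {R : realType}.
Variable P : probability T R.

Definition cond_prob (A B : set T) : R := fine (P (A `&` B)) / fine (P B).

Definition mutually_independent (I : set nat) (X : nat -> T -> R) : Prop :=
  forall (J : seq nat) (B : nat -> set R),
    uniq J -> [set` J] `<=` I -> (forall i, measurable (B i)) ->
    P (\bigcap_(i in [set` J]) X i @^-1` B i)
    = (\prod_(i <- J) P (X i @^-1` B i))%E.

Definition independent_systems (F G : set (set T)) : Prop :=
  forall A B, F A -> G B -> P (A `&` B) = (P A * P B)%E.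

End probabilistic_notions.

Definition natural_filtration {T : Type} {R : realType} (S : nat -> T -> R)
    (nu : nat) : set (set T) :=
  <<s \bigcup_(i in [set i | (i <= nu)%N])
        preimage_set_system [set: T] (S i) measurable >>.

(* pi_k = P(Ntil >= N - k | Ntil >= N - k - 1), for k < N. *)
Definition survival_prob {d : measure_display} {T : measurableType d}
    {R : realType} (P : probability T R) (N : nat) (Ntil : T -> nat)
    (k : nat) : R :=
  cond_prob P [set w | (N - k <= Ntil w)%N] [set w | (N - k.+1 <= Ntil w)%N].

(* Exercise times have values in {0, ..., N} together with None, which is
   the non-exercise value +oo.  A vector (sigma_m, ..., sigma_1) is a function
   nat -> T -> option 'I_N.+1 of which only the indices 1, ..., m are used. *)
Section exercise_times.
Context {T : Type} {N : nat}.

Definition stopping_time (F : nat -> set (set T)) (tau : T -> option 'I_N.+1) :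
    Prop :=
  forall nu : nat, (nu <= N)%N ->
    F nu [set w | if tau w is Some t then (t <= nu)%N else false].

Definition admissible (F : nat -> set (set T)) (m : nat)
    (sigma : nat -> T -> option 'I_N.+1) : Prop :=
  (forall i, (1 <= i <= m)%N -> stopping_time F (sigma i)) /\
  forall w, exists2 l : nat, (l <= m)%N &
    (forall i, (1 <= i <= m)%N -> isSome (sigma i w) = (m - l + 1 <= i)%N) /\
    (forall i j (s t : 'I_N.+1), (1 <= i)%N -> (i < j)%N -> (j <= m)%N ->
       sigma j w = Some s -> sigma i w = Some t -> (s < t)%N).

Definition first_time (A : pred 'I_N.+1) : option 'I_N.+1 :=
  [pick t | A t && [forall s, A s ==> (t <= s)%N]].

(* nth_exercise y X m k is sigma*_(m - k), the (k+1)-st exercise time. *)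
Fixpoint nth_exercise {R : realType} (y : nat -> nat -> R) (X : nat -> T -> R)
    (m k : nat) (w : T) : option 'I_N.+1 :=
  match k with
  | 0%N => first_time [pred nu : 'I_N.+1 | y m (N - nu)%N <= X nu w]
  | k'.+1 =>
      if nth_exercise y X m k' w is Some t then
        first_time [pred nu : 'I_N.+1 |
          (t < nu)%N && (y (m - k)%N (N - nu)%N <= X nu w)]
      else None
  end.

Definition threshold_schedule {R : realType} (y : nat -> nat -> R)
    (X : nat -> T -> R) (m i : nat) : T -> option 'I_N.+1 :=
  nth_exercise y X m (m - i).

Definition right_payoff {R : realType} (alpha : R) (Ntil : T -> nat)
    (M : nat -> T -> R) (sigma : nat -> T -> option 'I_N.+1) (i : nat) (w : T) :
    R :=
  if sigma i w is Some t then alpha ^+ t * (t <= Ntil w)%:R * M t w else 0.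

Definition total_payoff {R : realType} (alpha : R) (Ntil : T -> nat)
    (M : nat -> T -> R) (m : nat) (sigma : nat -> T -> option 'I_N.+1) (w : T) :
    R :=
  \sum_(1 <= i < m.+1) right_payoff alpha Ntil M sigma i w.

End exercise_times.

(* Main.v *)
(** The marginal value of the m-th right lies in the cone of nonnegative
    nondecreasing functions f on [1, +oo[ with f(x)/x nonincreasing, which is
    stable under the pricing operator, maxima and minima, because
    D^[m+1]_n = min(h^[m]_n, max(x, h^[m+1]_n)).  Hence {x >= h^[m]_n} is an upper
    interval, and comparing the h's compares the boundaries.  It is nonempty
    since the operator multiplies the identity by alpha < 1 far from 1.

    For the optimality, multiply the value of the remaining rights by
    alpha^t P(t <= Ntil) S_t: one step of the price process turns the
    continuation value at time t into the value at time t+1, so the expected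
    gains telescope.  They are at most the initial value for every admissible
    schedule, with equality for the threshold schedule, which always realizes
    the maximum in the recursion. *)
Require Import Defs.
From HB Require Import structures.
From mathcomp Require Import all_boot all_order all_algebra.
From mathcomp Require Import all_classical all_reals all_analysis.
From mathcomp Require Import measurable_realfun ring lra zify.
Import Order.TTheory GRing.Theory Num.Theory.
Import numFieldNormedType.Exports.
Local Open Scope classical_set_scope.
Local Open Scope ring_scope.

(** * Positivity of the transition weights *)

Section TransitionProbabilities.
Context {R : realType} {r lam : R}.
Hypotheses (r_gt0 : 0 < r) (lam_gt1 : 1 < lam).
Hypotheses (lamVr : lam^-1 < 1 + r) (r_lam : 1 + r < lam).

(** The min-max form of D^[m+1]_n is valid only when h^[m+1]_n <= h^[m]_n, so membership in the cone
    and decrease in m have to be proved in one induction on n.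

    Exercise times depend on prices alone and maturity is independent of prices; hence the survival
    indicator may be replaced by P(t <= Ntil) under the expectation, and successive ratios of these
    probabilities are the pi_k, read backwards from the horizon. Since M_t = S_t X_t, the factor S_t
    acts as a numeraire, and the tilted probabilities are the weights it induces on the two moves of
    X. The measure is not changed: S_t stays inside the integral.

    The number of rights left is random. The transition step works because the number left after the
    decision at t is known at t, so it can be carried as an index measurable in the past.
    Conditional expectations are then replaced by splitting integrals over the events of an up and a
    down step. All integrands are nonnegative, so integrability never has to be checked. *)

Lemma lam_gt0 : 0 < lam.
Proof. exact: lt_trans lam_gt1. Qed.

Lemma discount_gt0 : 0 < discount r.
Proof. by rewrite invr_gt0 addr_gt0. Qed.

Lemma discount_lt1 : discount r < 1.
Proof. by rewrite invf_lt1 ?addr_gt0// ltrDl. Qed.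

Lemma lamV_lt1 : lam^-1 < 1.
Proof. by rewrite invf_lt1 ?lam_gt0. Qed.

Lemma up_prob_gt0 : 0 < up_prob r lam.
Proof. by rewrite divr_gt0 ?subr_gt0// (lt_trans lamVr). Qed.

Lemma down_prob_gt0 : 0 < down_prob r lam.
Proof.
by rewrite subr_gt0 ltr_pdivrMr ?mul1r ?ltrD2r// subr_gt0 (lt_trans lamVr).
Qed.

Lemma tilted_up_prob_gt0 : 0 < tilted_up_prob r lam.
Proof.
by rewrite mulr_gt0 ?up_prob_gt0// mulr_gt0 ?discount_gt0// lam_gt0.
Qed.

Lemma tilted_down_prob_gt0 : 0 < tilted_down_prob r lam.
Proof.
by rewrite mulr_gt0 ?down_prob_gt0// mulr_gt0 ?discount_gt0// invr_gt0 lam_gt0.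
Qed.

End TransitionProbabilities.

(** * Marginal values, exercise regions and boundaries *)

Section DynamicProgramming.
Context {R : realType} {r lam : R} {surv : nat -> R}.
Local Notation value := (value r lam surv).
Local Notation marginal_value := (marginal_value r lam surv).
Local Notation marginal_continuation := (marginal_continuation r lam surv).
Local Notation exercise_region := (exercise_region r lam surv).
Local Notation boundary := (boundary r lam surv).

Implicit Types (m n : nat) (x y z : R).

(** The value 0 at n = 0 gives h^[m]_n as a difference of two continuation values at the horizon as
    well. *)
Definition continuation m n x : R :=
  if n is n'.+1 then Bop_at r lam surv n (value m n') x else 0.

Lemma BopB (f g : R -> R) x :
  Bop r lam (fun y => f y - g y) x = Bop r lam f x - Bop r lam g x.
Proof. rewrite /Bop; ring. Qed.

Lemma value0 n x : value 0 n x = 0.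
Proof. by case: n. Qed.

Lemma continuation0 n x : continuation 0 n x = 0.
Proof.
case: n => [//|n]; rewrite /continuation /Bop_at /Bop !value0.
by rewrite !mulr0 addr0 mulr0.
Qed.

(** At n = 0 the recursion would read max(x, 0), which is x only for x >= 0; the second disjunct
    postpones that sign condition. *)
Lemma valueS m n x :
  value m.+1 n x = Num.max (x + continuation m n x) (continuation m.+1 n x)
  \/ n = 0%N.
Proof. by case: n => [|n]; [right|left]. Qed.

Lemma marginal_continuationE m n x :
  marginal_continuation m n x = continuation m n x - continuation m.-1 n x.
Proof.
case: n => [|n]; first by rewrite subrr.
by rewrite /marginal_continuation /continuation /Bop_at -mulrBr -BopB.
Qed.

(** Taking the common continuation value of m rights out of the maximum isolates the exercise
    decision: x is compared with h^[m+1]_n. *)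
Lemma value_marginal m n x : (0 <= x) ->
  value m.+1 n x = continuation m n x + Num.max x (marginal_continuation m.+1 n x).
Proof.
move=> x0; rewrite marginal_continuationE /= addr_maxr.
have [->|->] := valueS m n x; first by congr Num.max; ring.
by rewrite /= subrr !add0r max_l.
Qed.

Lemma marginal_value1 n x : 0 <= x ->
  marginal_value 1 n x = Num.max x (marginal_continuation 1 n x).
Proof.
by move=> x0; rewrite /Defs.marginal_value /= value0 value_marginal// continuation0; ring.
Qed.

(** Difference of two instances of [value_marginal]. It presupposes no ordering of the h's, so it is
    available before the induction that establishes that ordering. *)
Lemma marginal_valueSS m n x : 0 <= x ->
  marginal_value m.+2 n x =
    marginal_continuation m.+1 n x + Num.max x (marginal_continuation m.+2 n x)
    - Num.max x (marginal_continuation m.+1 n x).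
Proof.
move=> x0; rewrite /Defs.marginal_value /= !value_marginal//.
rewrite (marginal_continuationE m.+1) /=; ring.
Qed.

(* Membership in this class makes [x <= f x] hold on a down-closed set. *)
Definition subhomogeneous (f : R -> R) :=
  [/\ forall x, 1 <= x -> 0 <= f x,
      forall x y, 1 <= x -> x <= y -> f x <= f y &
      forall x y, 1 <= x -> x <= y -> f y * x <= f x * y].

Lemma subhomogeneous_id : subhomogeneous (fun x => x).
Proof. by split => // [x x1|x y x1 xy]; [rewrite (le_trans _ x1)|rewrite mulrC]. Qed.

Lemma subhomogeneous0 : subhomogeneous (fun=> 0).
Proof. by split => // x y; rewrite !mul0r. Qed.

Lemma subhomogeneous_max f g :
  subhomogeneous f -> subhomogeneous g -> subhomogeneous (fun x => Num.max (f x) (g x)).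
Proof.
move=> [f0 fm fs] [g0 gm gs]; split => [x x1|x y x1 xy|x y x1 xy].
- by rewrite le_max f0.
- by rewrite ge_max !le_max fm// gm// orbT.
have x0 : 0 <= x by lra. have y0 : 0 <= y by lra.
by rewrite !maxr_pMl// ge_max !le_max fs// gs// orbT.
Qed.

Lemma subhomogeneous_min f g :
  subhomogeneous f -> subhomogeneous g -> subhomogeneous (fun x => Num.min (f x) (g x)).
Proof.
move=> [f0 fm fs] [g0 gm gs]; split => [x x1|x y x1 xy|x y x1 xy].
- by rewrite le_min f0// g0.
- by rewrite le_min !ge_min fm// gm// orbT.
have x0 : 0 <= x by lra. have y0 : 0 <= y by lra.
by rewrite !minr_pMl// le_min !ge_min fs// gs// orbT.
Qed.

Lemma eq_subhomogeneous f g :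
  (forall x, 1 <= x -> f x = g x) -> subhomogeneous f -> subhomogeneous g.
Proof.
move=> fg [f0 fm fs]; split => [x x1|x y x1 xy|x y x1 xy].
- by rewrite -fg ?f0.
- by rewrite -!fg ?fm// (le_trans x1).
- by rewrite -!fg ?fs// (le_trans x1).
Qed.

(** Here e is the number of rights used in the current period and k the number kept: no decision
    beats the recursion. *)
Lemma value_step e k n x : 0 <= x -> (e <= 1)%N ->
  x * e%:R + continuation k n x <= value (e + k) n x.
Proof.
move=> x0; case: e => [_|[_|//]].
  rewrite mulr0 add0r add0n; case: k => [|k]; first by rewrite value0 continuation0.
  by rewrite value_marginal// -lerBlDl -marginal_continuationE le_max lexx orbT.
by rewrite mulr1 add1n value_marginal// addrC lerD2l le_max lexx.
Qed.

(** The decision is prescribed only while a right is left; for e + k = 0 both sides vanish. *)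
Lemma value_step_eq e k n x : 0 <= x -> (e <= 1)%N ->
  ((0 < e + k)%N -> e = (marginal_continuation (e + k) n x <= x) :> nat) ->
  x * e%:R + continuation k n x = value (e + k) n x.
Proof.
move=> x0; case: e => [_|[_|//]].
  rewrite mulr0 add0r add0n; case: k => [|k]; first by rewrite value0 continuation0.
  move=> /(_ isT); case: leP => // xh _.
  by rewrite value_marginal// max_r ?ltW// marginal_continuationE addrC subrK.
rewrite mulr1 add1n value_marginal// => /(_ isT); case: leP => // xh _.
by rewrite addrC.
Qed.

Lemma measurable_Bop f : measurable_fun setT f -> measurable_fun setT (Bop r lam f).
Proof.
move=> mf; apply: measurable_funD; apply: measurable_funM; try exact: measurable_cst.
  by apply: (measurableT_comp mf); exact: measurable_maxr.
exact: measurableT_comp mf (mulrl_measurable lam).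
Qed.

Lemma measurable_value m n : measurable_fun setT (value m n).
Proof.
elim: n m => [|n IH] [|m]; try exact: measurable_cst; first exact: measurable_id.
have mB k : measurable_fun setT (Bop_at r lam surv n.+1 (value k n)).
  by apply: measurable_funM; [exact: measurable_cst|exact: measurable_Bop].
apply: measurable_maxr; last exact: mB.
by apply: measurable_funD => //; apply: mB.
Qed.

Lemma measurable_continuation m n : measurable_fun setT (continuation m n).
Proof.
case: n => [|n]; first exact: measurable_cst.
apply: measurable_funM; first exact: measurable_cst.
by apply: measurable_Bop; apply: measurable_value.
Qed.

Hypotheses (r_gt0 : 0 < r) (lam_gt1 : 1 < lam).
Hypotheses (lamVr : lam^-1 < 1 + r) (r_lam : 1 + r < lam).

Let lam0 : 0 < lam. Proof. exact: lam_gt0. Qed.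
Let lamV0 : 0 < lam^-1. Proof. by rewrite invr_gt0. Qed.
Let lamV1 : lam^-1 < 1. Proof. exact: lamV_lt1. Qed.
Let tp0 : 0 <= tilted_up_prob r lam.
Proof. by rewrite ltW// tilted_up_prob_gt0. Qed.
Let tq0 : 0 <= tilted_down_prob r lam.
Proof. by rewrite ltW// tilted_down_prob_gt0. Qed.

Lemma lam_ge1M x : 1 <= x -> 1 <= lam * x.
Proof. by move=> x1; rewrite -(mul1r 1) ler_pM// ltW. Qed.

(** Both moves, x -> max(lam^-1 x, 1) and x -> lam x, are nondecreasing with nonincreasing ratio to
    x, and composing f with such a map preserves the class. *)
Lemma subhomogeneous_Bop f : subhomogeneous f -> subhomogeneous (Bop r lam f).
Proof.
move=> [f0 fm fs].
have mx1 x : 1 <= Num.max (lam^-1 * x) 1 by rewrite le_max lexx orbT.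
have mono x y : x <= y -> Num.max (lam^-1 * x) 1 <= Num.max (lam^-1 * y) 1.
  by move=> xy; rewrite ge_max !le_max lexx orbT andbT ler_pM2l ?xy.
split => [x x1|x y x1 xy|x y x1 xy].
- by rewrite addr_ge0// mulr_ge0// ?f0// lam_ge1M.
- rewrite lerD// ler_wpM2l// fm ?lam_ge1M//; first exact: mono.
  by rewrite ler_pM2l.
have x0 : 0 < x by lra. have y0 : 0 < y by lra.
rewrite /Bop; move: (tilted_up_prob r lam) (tilted_down_prob r lam) tp0 tq0 => p q p0 q0.
rewrite !mulrDl -!mulrA lerD// ler_wpM2l//; last first.
  have := fs _ _ (lam_ge1M _ x1) (_ : lam * x <= lam * y).
  by rewrite ler_pM2l// => /(_ xy); rewrite !(mulrCA _ lam) ler_pM2l.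
set b := Num.max _ 1; set a := Num.max _ 1.
have a0 : 0 < a by apply: lt_le_trans (mx1 _).
have b0 : 0 < b by apply: lt_le_trans (mx1 _).
have bxay : b * x <= a * y.
  by rewrite /a /b (maxr_pMl _ _ (ltW x0)) (maxr_pMl _ _ (ltW y0)) !mul1r ge_max !le_max xy orbT mulrAC lexx.
(* The chain is f(b) x a <= f(a) b x <= f(a) a y, by the ratio property of f and then that of the
   capped move. *)
rewrite -(ler_pM2r a0); apply: (@le_trans _ _ (f a * (b * x))).
  by rewrite -mulrA (mulrC x) !mulrA ler_pM2r// fs ?mono//; apply: mx1.
by rewrite -mulrA (mulrC y) ler_wpM2l// f0//; apply: mx1.
Qed.

Lemma Bop_le f g x : (forall z, 1 <= z -> f z <= g z) -> 1 <= x ->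
  Bop r lam f x <= Bop r lam g x.
Proof.
move=> fg x1; rewrite lerD// ler_wpM2l// fg ?lam_ge1M//.
by rewrite le_max lexx orbT.
Qed.

Lemma subhomogeneousZ a f : 0 <= a -> subhomogeneous f ->
  subhomogeneous (fun x => a * f x).
Proof.
move=> a0 [f0 fm fs]; split => [x x1|x y x1 xy|x y x1 xy].
- by rewrite mulr_ge0// f0.
- by rewrite ler_wpM2l// fm.
- by rewrite -!mulrA ler_wpM2l// fs.
Qed.

(* For [x >= lam] the cap at 1 is inactive, and [Bop] multiplies the identity
   by the discount factor. *)
Lemma Bop_le_id f c : (forall x, c <= x -> f x <= x) -> 1 <= c ->
  forall x, lam * c <= x -> Bop r lam f x <= x.
Proof.
move=> fc c1 x cx.
have x1 : c <= lam^-1 * x by rewrite ler_pdivlMl.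
have x0 : 0 < x by rewrite -(pmulr_rgt0 _ lamV0) (lt_le_trans _ x1)// (lt_le_trans _ c1).
have lx1 : c <= lam * x.
  by apply: le_trans x1 _; rewrite ler_pM2r// ltW// (lt_trans lamV1).
rewrite /Bop max_l ?(le_trans c1)//.
apply: (@le_trans _ _ (tilted_up_prob r lam * (lam^-1 * x) +
  tilted_down_prob r lam * (lam * x))).
  by rewrite lerD// ler_wpM2l// fc.
have -> : tilted_up_prob r lam * (lam^-1 * x) +
  tilted_down_prob r lam * (lam * x) = discount r * x.
  rewrite /tilted_up_prob /tilted_down_prob /down_prob; field.
  by rewrite gt_eqF.
by rewrite ler_piMl// ltW// ?discount_lt1.
Qed.

Variable N : nat.
Hypotheses (surv01 : forall k, (k < N)%N -> 0 <= surv k <= 1).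

(** Each round passes from D at n to h at n+1 through the operator, then from h to D at n+1 through
    maxima and minima; the ordering in m travels the same way and is needed for the second
    passage. *)
Lemma marginals n : (n <= N)%N ->
  (forall m, subhomogeneous (marginal_value m.+1 n) /\
             subhomogeneous (marginal_continuation m.+1 n)) /\
  (forall m x, 1 <= x -> marginal_value m.+2 n x <= marginal_value m.+1 n x /\
      marginal_continuation m.+2 n x <= marginal_continuation m.+1 n x).
Proof.
elim: n => [|n IH] nN.
  (* At the horizon only one right can be used: D^[1]_0 is the identity and all further marginal
     values are 0. *)
  suff H m : (forall x, marginal_continuation m.+1 0 x = 0) /\
     forall x, marginal_value m.+1 0 x = if m is 0 then x else 0.
    split => [m|m x x1].
      split; [apply: (@eq_subhomogeneous (if m is 0 then fun x=> x else fun=> 0))|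
        exact: subhomogeneous0].
      + by move=> x _; rewrite (H m).2; case: (m).
      + by case: (m) => [|_]; [exact: subhomogeneous_id|exact: subhomogeneous0].
    rewrite (H m).2 (H m.+1).2; split => //; case: (m) => //; lra.
  by split => // x; case: m => [|m]; rewrite /Defs.marginal_value /= ?subr0 ?subrr.
have [IH1 IH2] := IH (ltnW nN).
have /andP[p0 p1] := surv01 _ nN.
have sH m : subhomogeneous (marginal_continuation m.+1 n.+1).
  by apply: subhomogeneousZ => //; apply: subhomogeneous_Bop; apply: (IH1 m).1.
have dH m x : 1 <= x -> marginal_continuation m.+2 n.+1 x <= marginal_continuation m.+1 n.+1 x.
  by move=> x1; rewrite ler_wpM2l// Bop_le// => z z1; apply: (IH2 m z z1).1.
have D1 x : 1 <= x -> Num.max x (marginal_continuation 1 n.+1 x) = marginal_value 1 n.+1 x.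
  by move=> x1; rewrite marginal_value1//; lra.
have D2 m x : 1 <= x ->
  Num.min (marginal_continuation m.+1 n.+1 x) (Num.max x (marginal_continuation m.+2 n.+1 x))
   = marginal_value m.+2 n.+1 x.
  (* With b <= a: if x >= a, both maxima equal x and a remains; if x < a, the maximum of x and a is
     a and cancels. *)
  move=> x1; rewrite marginal_valueSS; last lra.
  have := dH m x x1; set a := marginal_continuation _ _ _; set b := marginal_continuation _ _ _.
  by move: a b => a b; rewrite /Num.min /Num.max; do !case: ifP; lra.
split => [m|m x x1]; split => //.
- case: m => [|m].
    by apply: eq_subhomogeneous D1 _; apply: subhomogeneous_max => //; apply: subhomogeneous_id.
  apply: eq_subhomogeneous (D2 m) _; apply: subhomogeneous_min => //.
  by apply: subhomogeneous_max => //; apply: subhomogeneous_id.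
- case: m => [|m]; first by rewrite -D1// -D2// ge_min le_max lexx orbT.
  (* The left side is at most h^[m+2], which lies below both h^[m+1] and max(x, h^[m+2]). *)
  rewrite -!D2// le_min; apply/andP; split; first by rewrite ge_min dH.
  by rewrite ge_min le_max lexx orbT.
- exact: dH.
Qed.

(** The induction produces c = lam^n, uniformly in m: from x >= lam^n the cap at 1 stays inactive
    during all n remaining steps. *)
Lemma marginal_le_id n : (n <= N)%N -> exists2 c, 1 <= c &
  forall m x, c <= x -> marginal_value m.+1 n x <= x /\ marginal_continuation m.+1 n x <= x.
Proof.
elim: n => [|n IH] nN.
  exists 1 => // m x x1; split; last by rewrite /=; lra.
  by case: m => [|m]; rewrite /Defs.marginal_value /=; lra.
have [c c1 Hc] := IH (ltnW nN).
have /andP[p0 p1] := surv01 _ nN.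
have lc : 1 <= lam * c by exact: lam_ge1M.
exists (lam * c) => // m x cx.
have Hx k : marginal_continuation k.+1 n.+1 x <= x.
  have := Bop_le_id _ _ (fun x xc => (Hc k x xc).1) c1 _ cx.
  rewrite /Defs.marginal_continuation /Bop_at /=.
  have [/(_ k)[sD _] _] := marginals _ (ltnW nN).
  have [/(_ x)] := subhomogeneous_Bop _ sD.
  rewrite (le_trans lc)// => /(_ isT) B0 _ _ Bx.
  by rewrite (le_trans _ Bx)// ler_piMl.
split => //; case: m => [|m]; first by rewrite marginal_value1 ?max_l//; lra.
(* Both maxima equal x, so D^[m+2] reduces to h^[m+1]. *)
rewrite marginal_valueSS; last lra.
have := Hx m; have := Hx m.+1; move=> ? ?; rewrite !max_l//; lra.
Qed.

(** The left end belongs to the region without any appeal to continuity of h: above the infimum the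
    ratio property applies, and at the infimum h(x) <= h(x + e) <= x + e for every e > 0 by
    monotonicity. *)
Lemma exercise_region_boundary m n : (0 < m)%N -> (n <= N)%N ->
  has_inf (exercise_region m n) /\ exercise_region m n = [set x | boundary m n <= x].
Proof.
case: m => // m _ nN.
have [/(_ m)[_ [h0 hm hs]] _] := marginals n nN.
have [c c1 Hc] := marginal_le_id n nN.
have hi : has_inf (exercise_region m.+1 n).
  split; last by exists 1 => x [].
  by exists c; split => //; apply: (Hc m c _).2.
split => //; rewrite predeqE => x /=; split.
  by move=> Ex; apply: ge_inf => //; case: hi.
move=> bx.
have y1 : 1 <= boundary m.+1 n by apply: lb_le_inf => [|z []//]; case: hi.
have up z : boundary m.+1 n < z -> marginal_continuation m.+1 n z <= z.
  move=> bz; have [w [w1 Hw] wz] := inf_lt hi.1 bz.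
  have w0 : 0 < w by lra.
  have := hs w z w1 (ltW wz) => Hwz; rewrite -(ler_pM2r w0).
  by rewrite (le_trans Hwz)// mulrC ler_wpM2l//; lra.
have x1 : 1 <= x by rewrite (le_trans y1).
split => //; apply/ler_addgt0Pr => e e0.
have xe : x < x + e by rewrite ltrDl.
by rewrite (le_trans (hm _ _ x1 (ltW xe)))// up// (le_lt_trans bx).
Qed.

Lemma le_boundary m n m' n' : (0 < m)%N -> (n <= N)%N -> (0 < m')%N -> (n' <= N)%N ->
  (forall x, 1 <= x -> marginal_continuation m n x <= marginal_continuation m' n' x) ->
  boundary m n <= boundary m' n'.
Proof.
move=> m0 nN m'0 n'N H.
have [_ E] := exercise_region_boundary _ _ m0 nN.
have [_ E'] := exercise_region_boundary _ _ m'0 n'N.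
suff : exercise_region m n (boundary m' n') by rewrite E.
have : exercise_region m' n' (boundary m' n') by rewrite E' /=.
by move=> [x1 hx]; split => //; apply: le_trans hx; apply: H.
Qed.

Lemma boundaryS_le m n : (0 < m)%N -> (n <= N)%N -> boundary m.+1 n <= boundary m n.
Proof.
case: m => // m _ nN; apply: le_boundary => // x x1.
by have [_ /(_ m x x1)[]] := marginals n nN.
Qed.

Lemma boundary0 m : (0 < m)%N -> boundary m 0 = 1.
Proof.
move=> m0; rewrite /Defs.boundary (_ : exercise_region m 0 = [set x | x \in `[1, +oo[%R]).
  by rewrite inf_itv.
rewrite predeqE => x /=; rewrite in_itv /= andbT; split => [[]|x1]//.
by split => //=; lra.
Qed.

Lemma marginal_valueSS_min m n x : (n <= N)%N -> 1 <= x ->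
  marginal_value m.+2 n x =
  Num.min (marginal_continuation m.+1 n x) (Num.max x (marginal_continuation m.+2 n x)).
Proof.
move=> nN x1; rewrite marginal_valueSS; last lra.
have [_ /(_ m x x1)[_]] := marginals n nN.
set a := marginal_continuation _ _ _; set b := marginal_continuation _ _ _.
by move: a b => a b; rewrite /Num.min /Num.max; do !case: ifP; lra.
Qed.

(** In min-max form the marginal value is visibly monotone in both h's, unlike in difference form,
    so an increase of all h's from n to n+1 passes to the D's and through the operator.
    Nonnegativity of the operator's output allows pi_n to be replaced by the larger pi_(n+1). *)
Lemma marginal_continuation_homo : (forall k, (k.+1 < N)%N -> surv k <= surv k.+1) ->
  forall n, (n < N)%N -> forall m x, 1 <= x ->
    marginal_continuation m.+1 n x <= marginal_continuation m.+1 n.+1 x.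
Proof.
move=> surv_le; elim=> [|n IH] nN m x x1.
  by have [/(_ m)[_ [+ _ _]] _] := marginals 1 nN; apply.
have Dle z : 1 <= z -> marginal_value m.+1 n z <= marginal_value m.+1 n.+1 z.
  move=> z1; have h k := IH (ltnW nN) k z z1.
  case: m {x x1} => [|m].
    by rewrite !marginal_value1; [rewrite ge_max !le_max lexx h orbT|lra|lra].
  rewrite !marginal_valueSS_min// ?(ltnW (ltnW nN)) ?(ltnW nN)//.
  rewrite le_min; apply/andP; split; first by rewrite ge_min h.
  by rewrite ge_min ge_max !le_max lexx h !orbT.
have [/(_ m)[/subhomogeneous_Bop [/(_ x x1) B0 _ _] _] _] := marginals n (ltnW (ltnW nN)).
have /andP[p0 _] := surv01 _ (ltnW nN); have /andP[q0 _] := surv01 _ nN.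
apply: (@le_trans _ _ (surv n.+1 * Bop r lam (marginal_value m.+1 n) x)).
  by rewrite ler_wpM2r// surv_le.
by rewrite ler_wpM2l// Bop_le.
Qed.

Lemma boundary_homo : (forall k, (k.+1 < N)%N -> surv k <= surv k.+1) ->
  forall m n, (0 < m)%N -> (n < N)%N -> boundary m n <= boundary m n.+1.
Proof.
move=> surv_le [//|m] n _ nN; apply: le_boundary => //; first exact: ltnW.
exact: marginal_continuation_homo.
Qed.

Lemma value_ge0 m n x : (n <= N)%N -> 1 <= x -> 0 <= value m n x.
Proof.
move=> nN x1; elim: m => [|m IH]; first by rewrite value0.
have [/(_ m)[[/(_ x x1)]]] := marginals n nN.
by rewrite subr_ge0 => /(le_trans IH).
Qed.

Lemma continuation_ge0 m n x : (n <= N)%N -> 1 <= x -> 0 <= continuation m n x.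
Proof.
case: n => // n nN x1; have /andP[p0 _] := surv01 _ nN.
apply: mulr_ge0 => //; apply: addr_ge0; apply: mulr_ge0 => //; apply: value_ge0.
- exact: ltnW.
- by rewrite le_max lexx orbT.
- exact: ltnW.
- exact: lam_ge1M.
Qed.

End DynamicProgramming.

(** * Counting rights along a path *)

Section ExerciseSchedules.
Context {N : nat}.
Implicit Types (s : nat -> option 'I_N.+1) (o : option 'I_N.+1) (t m k : nat).

Definition before o t : bool := if o is Some u then (u < t)%N else false.

Definition at_time o t : bool := if o is Some u then (u == t :> nat) else false.

(** Rights held just before the decision at t; a right that is never exercised counts at all
    times. *)
Definition remaining m s t : nat := (\sum_(1 <= i < m.+1) ~~ before (s i) t)%N.

Definition exercises m s t : nat := (\sum_(1 <= i < m.+1) at_time (s i) t)%N.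

Lemma remainingE m s t :
  remaining m s t = (exercises m s t + remaining m s t.+1)%N.
Proof.
rewrite /remaining /exercises -big_split /=; apply: eq_bigr => i _.
by case: (s i) => //= u; rewrite ltnS; case: ltngtP.
Qed.

Lemma remaining0 m s : remaining m s 0 = m.
Proof.
rewrite /remaining (eq_bigr (fun=> 1%N)); last by move=> i _; case: (s i).
by rewrite sum_nat_const_nat muln1 subn1.
Qed.

Lemma exercises_le1 m s t :
  (forall i j u v, (1 <= i)%N -> (i < j)%N -> (j <= m)%N ->
     s j = Some u -> s i = Some v -> (u < v)%N) ->
  (exercises m s t <= 1)%N.
Proof.
move=> sdec; rewrite /exercises.
have [/hasP[i]|/hasPn H] := boolP (has (fun i => at_time (s i) t) (index_iota 1 m.+1)).
  move=> im ai; rewrite (bigD1_seq i) ?iota_uniq//= ai big1_seq ?addn0// => j /andP[ji].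
  move: im; rewrite !mem_index_iota !ltnS => /andP[i1 im] /andP[j1 jm].
  apply/eqP; rewrite eqb0; apply/negP; move: ai.
  case Ei: (s i) => [u|//]; case Ej: (s j) => [v|//] /= /eqP ut /eqP vt.
  move: ji; rewrite neq_ltn => /orP[ji|ij].
    by have := sdec j i u v j1 ji im Ei Ej; rewrite ut vt ltnn.
  by have := sdec i j v u i1 ij jm Ej Ei; rewrite ut vt ltnn.
by rewrite big1_seq// => i /andP[_ /H]; case: at_time.
Qed.

(** The dynamic programming recursion runs over dates, so the payoff is regrouped by date instead of
    by right. *)
Lemma total_payoffE {T : Type} {R : realType} (alpha : R) (Ntil : T -> nat)
    (M : nat -> T -> R) m (sigma : nat -> T -> option 'I_N.+1) w :
  total_payoff alpha Ntil M m sigma w =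
  \sum_(t < N.+1) alpha ^+ t * (t <= Ntil w)%:R * M t w
                  * (exercises m (sigma^~ w) t)%:R.
Proof.
rewrite /total_payoff; under [RHS]eq_bigr do rewrite /exercises natr_sum mulr_sumr.
rewrite exchange_big; apply: eq_bigr => i _; rewrite /right_payoff.
case: (sigma i w) => [u|] /=; last by rewrite big1// => t _; rewrite mulr0.
rewrite (bigD1 u)//= eqxx mulr1 big1 ?addr0// => t tu.
have -> : (u == t :> nat) = false by apply/negbTE; rewrite -val_eqE eq_sym in tu.
by rewrite mulr0.
Qed.

Lemma nonincreasing_bool_sumE m (b : nat -> bool) :
  (forall i, (0 < i < m)%N -> b i.+1 -> b i) ->
  forall i, (0 < i <= m)%N -> b i = (i <= \sum_(1 <= j < m.+1) b j)%N.
Proof.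
move=> bm i im.
have {}bm j k : (0 < j)%N -> (j <= k)%N -> (k <= m)%N -> b k -> b j.
  move=> j0; elim: k => [|k IH]; first by rewrite leqNgt j0.
  rewrite leq_eqVlt => /orP[/eqP->//|jk] km bk.
  by apply: IH => //; [exact: ltnW|apply: bm => //; rewrite km (leq_trans j0)].
elim: m im bm => [|m IH]; first by move=> /andP[i0]; rewrite leqNgt i0.
move=> /andP[i0 im] bm; rewrite big_nat_recr//=.
case bm1 : (b m.+1).
  rewrite (bm i m.+1)// (eq_big_nat _ _ (F2 := fun=> 1%N)) => [|j /andP[j0 jm]].
    by rewrite sum_nat_const_nat subn1 muln1 addn1 im.
  by rewrite (bm j m.+1)// ltnW.
rewrite addn0; move: im; rewrite leq_eqVlt => /orP[/eqP->|im].
  rewrite bm1; symmetry; apply/negbTE; rewrite -ltnNge ltnS.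
  rewrite -[leqRHS]muln1 -[X in (_ <= X * _)%N](subn1 m.+1) -sum_nat_const_nat.
  by apply: leq_sum => j _; case: (b j).
by apply: IH; [rewrite i0|move=> j k j0 jk km; apply: bm => //; exact: leqW].
Qed.

Lemma first_timeP (A : pred 'I_N.+1) :
  match first_time A with
  | Some t => A t /\ forall u, A u -> (t <= u)%N
  | None => forall u, ~~ A u
  end.
Proof.
rewrite /first_time; case: pickP => [t /andP[At /forallP H]|H].
  by split => // u Au; have := H u; rewrite Au.
move=> u; apply/negP => Au.
case: (arg_minnP (fun t : 'I_N.+1 => t : nat) Au) => t At tmin.
by have := H t; rewrite At /= => /forallP[]; move=> v; apply/implyP/tmin.
Qed.

End ExerciseSchedules.

(** * The threshold schedule along a fixed path *)

Section ThresholdSchedule.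
Context {R : realType} {T : Type} {N : nat}.
Variables (y : nat -> nat -> R) (X : nat -> T -> R) (m : nat) (w : T).

Let s i : option 'I_N.+1 := threshold_schedule y X m i w.
Let hit i (t : nat) : bool := y i (N - t)%N <= X t w.
(** Right m is used first and has no predecessor; right i < m waits until right i + 1 has been used
    strictly earlier. *)
Let after i (t : nat) : bool := if i == m then true else before (s i.+1) t.

Lemma threshold_scheduleE i : (0 < i <= m)%N ->
  s i = first_time [pred t : 'I_N.+1 | after i t && hit i t].
Proof.
move=> /andP[i0 im]; rewrite /after; case: eqP => [->|/eqP ne_im].
  by rewrite /s /threshold_schedule subnn.
have {ne_im} im : (i < m)%N by rewrite ltn_neqAle ne_im.
rewrite /s /threshold_schedule -(subnSK im) /= /hit.
case: nth_exercise => [u|] /=.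
  by rewrite subnSK// subKn// ltnW.
have := first_timeP [pred t : 'I_N.+1 | false && (y i (N - t)%N <= X t w)].
by case: first_time => [u []|].
Qed.

Lemma threshold_at_time i (t : 'I_N.+1) : (0 < i <= m)%N ->
  at_time (s i) t = [&& after i t, hit i t & ~~ before (s i) t].
Proof.
move=> im; rewrite threshold_scheduleE//.
set A := [pred t | _]; have := first_timeP A.
rewrite andbA -[after i t && hit i t]/(A t).
case: first_time => [u [Au umin]|nA] /=; last by rewrite andbT; apply/esym/negbTE/nA.
case: eqP => [ut|ut].
  by rewrite -(ord_inj ut) ltnn andbT; apply/esym.
apply/esym/negbTE/negP => /andP[/umin ut'].
by rewrite -leqNgt => tu; apply: ut; apply/eqP; rewrite eqn_leq ut' tu.
Qed.

Lemma threshold_Some i (t : 'I_N.+1) : (0 < i <= m)%N -> s i = Some t ->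
  after i t /\ hit i t.
Proof.
move=> im sit; have := threshold_at_time i t im.
by rewrite {1}sit /= eqxx => /esym/and3P[].
Qed.

Lemma threshold_beforeS i t : (0 < i < m)%N -> before (s i) t -> before (s i.+1) t.
Proof.
move=> /andP[i0 im]; case Ei: (s i) => [u|//] /= ut.
have [|+ _] := threshold_Some _ _ _ Ei; first by rewrite i0 ltnW.
rewrite /after (ltn_eqF im); case: (s i.+1) => [v|//] /= vu.
exact: ltn_trans ut.
Qed.

Lemma threshold_remaining i t : (0 < i <= m)%N ->
  ~~ before (s i) t = (i <= remaining m s t)%N.
Proof.
move=> im; apply: (@nonincreasing_bool_sumE m (fun i => ~~ before (s i) t)) => //.
by move=> j jm; apply: contraNN; apply: threshold_beforeS.
Qed.

Lemma remaining_le n s' t : (remaining (N := N) n s' t <= n)%N.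
Proof. by rewrite -[leqRHS](remaining0 n s') ; apply: leq_sum => i _; case: (s' i) => //= u; case: ltnP. Qed.

(** With k rights left, right k alone is eligible at t: those of larger index are used, and those of
    smaller index still wait for a predecessor. Hence the schedule follows the boundary y^[k], as
    the recursion with k rights prescribes. *)
Lemma threshold_exercises (t : 'I_N.+1) (k := remaining m s t) :
  exercises m s t = (0 < k)%N && hit k t :> nat.
Proof.
have km : (k <= m)%N by apply: remaining_le.
have atE i : (0 < i <= m)%N -> at_time (s i) t = (i == k) && hit k t.
  move=> im; rewrite threshold_at_time// threshold_remaining// -/k.
  have -> : after i t = (k <= i)%N.
    rewrite /after; case: eqP => [->|/eqP ne]; first by rewrite km.
    have im' : (0 < i.+1 <= m)%N by move: im ne; lia.
    by rewrite -[LHS]negbK threshold_remaining// -/k -leqNgt.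
  by case: ltngtP => [||->] //=; rewrite ?andbF ?andbT.
rewrite /exercises (eq_big_nat _ _ (F2 := fun i => ((i == k) && hit k t) : nat)); last first.
  by move=> i /andP[i0 im]; rewrite atE// i0.
have [k0|k0] := posnP k.
  by rewrite big_nat big1// => i /andP[i0 _]; rewrite k0 gtn_eqF.
rewrite (bigD1_seq k) ?iota_uniq ?mem_index_iota ?k0//= eqxx big1 ?addn0// => i ne.
by rewrite (negbTE ne).
Qed.

Lemma threshold_isSomeS i : (0 < i < m)%N -> isSome (s i) -> isSome (s i.+1).
Proof.
(* Being used before N + 1 means being used at all. *)
move=> im; have := @threshold_beforeS i N.+1 im.
by case: (s i) => [u|//] /= /(_ (ltn_ord u)); case: (s i.+1).
Qed.

(** When right i is used at v, right i + 1 is gone, so at most i rights are left before the decision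
    at v; as j > i, right j is gone too. *)
Lemma threshold_ltn i j (u v : 'I_N.+1) : (0 < i)%N -> (i < j)%N -> (j <= m)%N ->
  s j = Some u -> s i = Some v -> (u < v)%N.
Proof.
move=> i0 ij jm sj si.
have im : (0 < i < m)%N by rewrite i0 (leq_trans ij).
have [|+ _] := threshold_Some _ _ _ si; first by lia.
rewrite /after ltn_eqF; last lia.
move=> bi; have := threshold_remaining j v; rewrite sj /= => Hj.
have := threshold_remaining i.+1 v; rewrite bi /= => Hi.
by move: Hi Hj; case: ltnP => //; lia.
Qed.

Lemma threshold_finite : exists2 l : nat, (l <= m)%N &
  (forall i, (1 <= i <= m)%N -> isSome (s i) = (m - l + 1 <= i)%N).
Proof.
set b := fun i => ~~ isSome (s i); pose K := (\sum_(1 <= j < m.+1) b j)%N.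
have bE : forall i, (0 < i <= m)%N -> b i = (i <= K)%N.
  by apply: nonincreasing_bool_sumE => i im; apply: contraNN; apply: threshold_isSomeS.
have Km : (K <= m)%N.
  by rewrite -[leqRHS](remaining0 m s); apply: leq_sum => i _; rewrite /b; case: (s i).
exists (m - K)%N; first exact: leq_subr.
by move=> i im; rewrite -[LHS]negbK -/(b i) bE// subKn// addn1 ltnNge.
Qed.

Lemma threshold_expired (alpha : R) (Ntil : T -> nat) (M : nat -> T -> R) i j : (0 < j <= i)%N -> (i <= m)%N ->
  (if s i is Some t then (Ntil w < t)%N else true) ->
  right_payoff alpha Ntil M (threshold_schedule (N := N) y X m) j w = 0.
Proof.
move=> /andP[j0 ji] im dead; rewrite /right_payoff -/(s j).
case Ej: (s j) => [v|//].
suff /negbTE-> : ~~ (v <= Ntil w)%N by rewrite mulr0 mul0r.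
rewrite -ltnNge; move: ji; rewrite leq_eqVlt => /orP[/eqP ji|ji].
  by rewrite -ji Ej in dead.
have [l lm someE] := threshold_finite.
case Ei: (s i) dead => [u|] dead.
  exact: ltn_trans dead (threshold_ltn j i u v j0 ji im Ei Ej).
have := someE i; rewrite Ei; have := someE j; rewrite Ej /=; lia.
Qed.

End ThresholdSchedule.

(** * Integration over independent events and measurability with a random index *)

Section Independence.
Context {d : measure_display} {T : measurableType d} {R : realType}.
Context (P : probability T R).

Lemma sub_sigma_measurable (G : set (set T)) : G `<=` measurable ->
  <<s G >> `<=` measurable.
Proof. by apply: smallest_sub; apply: sigma_algebra_measurable. Qed.

Lemma measurable_fun_sub_sigma {d'} {U : measurableType d'} (G : set (set T)) (f : T -> U) :
  G `<=` measurable -> measurable_fun (setT : set (g_sigma_algebraType G)) f ->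
  measurable_fun (setT : set T) f.
Proof.
by move=> Gm mf _ Y mY; apply: (sub_sigma_measurable _ Gm); apply: mf.
Qed.

Lemma integral_mrestr (B : set T) (mB : measurable B) (f : T -> \bar R) :
  measurable_fun setT f -> (forall w, 0 <= f w)%E ->
  (\int[mrestr P mB]_w f w = \int[P]_(w in B) f w)%E.
Proof.
move=> mf f0; rewrite (@ge0_negligible_integral _ _ _ _ _ (~` B))//.
- rewrite setTD setCK; apply: eq_measure_integral => A mA AB.
  by rewrite /mrestr; congr (P _); apply/setIidPl.
- exact: measurableC.
- by transitivity (P (~` B `&` B)) => //; rewrite setICl measure0.
Qed.

(** On the sigma-algebra generated by G the measures A -> P(A [&] B) and P(B) P coincide. Pushing
    both forward along the identity into that sigma-algebra lets the integral of f depend on nothing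
    else. *)
Lemma integral_independent (G : set (set T)) (B : set T) (f : T -> R) :
  G `<=` measurable -> measurable B ->
  (forall A, <<s G >> A -> P (A `&` B) = P A * P B)%E ->
  measurable_fun (setT : set (g_sigma_algebraType G)) f -> (forall w, 0 <= f w) ->
  (\int[P]_(w in B) (f w)%:E = P B * \int[P]_w (f w)%:E)%E.
Proof.
move=> Gm mB indep mf f0.
have mphi : measurable_fun setT (idfun : T -> g_sigma_algebraType G).
  by apply: (@measurable_fun_sub_sigma _ _ G) => //; apply: measurable_id.
have k0 : 0 <= fine (P B) by rewrite fine_ge0.
have PBE : P B = (fine (P B))%:E by rewrite fineK// fin_num_measure.
have mfE : measurable_fun (setT : set (g_sigma_algebraType G)) (EFin \o f).
  exact/measurable_EFinP.
have mfT : measurable_fun (setT : set T) (EFin \o f).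
  exact: measurable_fun_sub_sigma mfE.
have g0 w : (0 <= (EFin \o f) w)%E by rewrite lee_fin.
have E1 := ge0_integral_pushforward mphi (mrestr P mB) measurableT mfE (fun w _ => g0 w).
have E2 := ge0_integral_pushforward mphi P measurableT mfE (fun w _ => g0 w).
apply: etrans (etrans (esym E1) _); first by rewrite -integral_mrestr.
move: E2; rewrite [RHS](_ : _ = \int[P]_w (f w)%:E)%E// => <-.
rewrite [X in (X * _)%E]PBE -[X in (X%:E * _)%E]/((NngNum k0)%:num).
rewrite -ge0_integral_mscale//.
apply: eq_measure_integral => A mA _.
by rewrite /= /mscale /pushforward /= /mrestr indep// muleC [in LHS]PBE.
Qed.

End Independence.

(** The index k is the random number of rights; preimages split into countably many pieces according
    to its value. *)
Lemma measurable_fun_indexed {d d'} {T : measurableType d} {U : measurableType d'}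
    {R : realType} (k : T -> nat) (phi : nat -> U -> R) (Y : T -> U) :
  measurable_fun setT k -> (forall n, measurable_fun setT (phi n)) ->
  measurable_fun setT Y -> measurable_fun setT (fun w => phi (k w) (Y w)).
Proof.
move=> mk mphi mY _ Z mZ; rewrite setTI.
rewrite (_ : _ @^-1` Z = \bigcup_n (k @^-1` [set n] `&` (phi n \o Y) @^-1` Z)).
  apply: bigcupT_measurable => n; apply: measurableI.
    by rewrite -[X in measurable X]setTI; apply: mk.
  by rewrite -[X in measurable X]setTI; apply: (measurableT_comp (mphi n) mY).
apply/seteqP; split => [w Zw|w [n _ [<-]]//].
by exists (k w).
Qed.

Lemma measurable_fun_sumn {d} {T : measurableType d} (I : Type) (s : seq I)
    (A : pred I) (f : I -> T -> nat) :
  (forall i, A i -> measurable_fun setT (f i)) ->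
  measurable_fun setT (fun w => \sum_(i <- s | A i) f i w)%N.
Proof.
move=> mf; elim: s => [|i s IH].
  by under eq_fun do rewrite big_nil; apply: measurable_cst.
have [Ai|nAi] := boolP (A i).
  under eq_fun do rewrite big_cons Ai.
  by apply: measurable_fun_addn => //; apply: mf.
by under eq_fun do rewrite big_cons (negbTE nAi).
Qed.

(** * Path dynamics of the price and of the ratio to its maximum *)

Section PriceProcess.
Context {R : realType} {T : Type}.
Variables (lam s0 m0 : R) (eps : nat -> T -> R).
Hypotheses (lam_gt0 : 0 < lam) (s0_gt0 : 0 < s0) (s0_m0 : s0 <= m0).
Local Notation S := (price lam s0 eps).
Local Notation M := (running_max lam s0 m0 eps).
Local Notation X := (max_ratio lam s0 m0 eps).

Lemma price_gt0 t w : 0 < S t w.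
Proof. by rewrite mulr_gt0// powR_gt0. Qed.

Lemma priceS t w : S t.+1 w = S t w * lam `^ eps t.+1 w.
Proof.
rewrite /price big_nat_recr//= powRD ?mulrA//.
by rewrite (gt_eqF lam_gt0) implybT.
Qed.

Lemma running_maxS t w : M t.+1 w = Num.max (M t w) (S t.+1 w).
Proof.
(* The initial value m0 is not neutral for the maximum, so the last term is split off by induction
   on the list. *)
have gen (s : seq nat) i : \big[Num.max/m0]_(j <- rcons s i) S j w =
    Num.max (\big[Num.max/m0]_(j <- s) S j w) (S i w).
  elim: s => [|j s IH]; first by rewrite big_cons !big_nil maxC.
  by rewrite rcons_cons !big_cons IH maxA.
rewrite /running_max /index_iota !subn0 -[t.+2]addn1 iotaD add0n cats1.
exact: gen.
Qed.

Lemma price_le_running_max t w : S t w <= M t w.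
Proof.
case: t => [|t]; last by rewrite running_maxS le_max lexx orbT.
by rewrite /running_max big_nat1_id le_max lexx.
Qed.

Lemma max_ratio_ge1 t w : 1 <= X t w.
Proof. by rewrite ler_pdivlMr ?price_gt0// mul1r price_le_running_max. Qed.

Lemma price_max_ratio t w : S t w * X t w = M t w.
Proof. by rewrite mulrC divfK// gt_eqF ?price_gt0. Qed.

Lemma max_ratioS t w :
  X t.+1 w = Num.max (X t w / lam `^ eps t.+1 w) 1.
Proof.
have S0 := price_gt0 t w.
have S1 := price_gt0 t.+1 w.
have l1 : 0 < lam `^ eps t.+1 w by rewrite powR_gt0.
rewrite /max_ratio running_maxS maxr_pMl ?invr_ge0 ?ltW// divff ?gt_eqF//.
by congr Num.max; rewrite priceS invfM mulrA.
Qed.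

Lemma max_ratioS_up t w : eps t.+1 w = 1 ->
  X t.+1 w = Num.max (lam^-1 * X t w) 1.
Proof. by move=> e; rewrite max_ratioS e powRr1 ?ltW// mulrC. Qed.

Lemma max_ratioS_down t w : 1 < lam -> eps t.+1 w = -1 -> X t.+1 w = lam * X t w.
Proof.
move=> lam1 e; rewrite max_ratioS e powR_inv1 ?ltW// invrK mulrC max_l//.
by rewrite mulr_ege1 ?max_ratio_ge1// ltW.
Qed.

(** The generators of [natural_filtration], named so that they can index the measurable space
    carried by its sigma-algebra. *)
Definition price_events (t : nat) : set (set T) :=
  \bigcup_(i in [set i | (i <= t)%N]) preimage_set_system [set: T] (S i) measurable.

Lemma natural_filtration_homo t u : (t <= u)%N ->
  natural_filtration S t `<=` natural_filtration S u.
Proof.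
move=> tu; apply: smallest_sub; first exact: smallest_sigma_algebra.
move=> A [i it SA]; apply: sub_sigma_algebra; exists i => //.
exact: leq_trans tu.
Qed.

End PriceProcess.

(** * Adaptedness, and independence of the next step from past prices *)

Section Model.
Context {d : measure_display} {T : measurableType d} {R : realType}.
Context {P : probability T R} {eps : nat -> {RV P >-> R}}.
Local Notation epsf := (fun i => eps i : T -> R).

Section Measurability.
Variables (lam s0 m0 : R).
Hypotheses (lam_gt0 : 0 < lam) (s0_gt0 : 0 < s0) (s0_m0 : s0 <= m0).
Local Notation S := (price lam s0 epsf).
Local Notation M := (running_max lam s0 m0 epsf).
Local Notation X := (max_ratio lam s0 m0 epsf).
Local Notation events := (price_events lam s0 epsf).
Local Notation "t .-measurable_fun" :=
  (measurable_fun (setT : set (g_sigma_algebraType (events t)))) (at level 2).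

(** The space U is arbitrary because the lemma serves both the ambient sigma-algebra and the one
    generated by the first t steps. *)
Lemma measurable_price_steps {d'} {U : measurableType d'} (f : nat -> U -> R) t :
  (forall i, (1 <= i <= t)%N -> measurable_fun setT (f i)) ->
  measurable_fun setT (price lam s0 f t).
Proof.
move=> mf; apply: measurable_funM; first exact: measurable_cst.
apply: (measurableT_comp (measurable_powRr lam)).
rewrite (_ : (fun w => _) =
  fun w => \sum_(i <- index_iota 1 t.+1) (if (1 <= i <= t)%N then f i w else 0)).
  apply: measurable_sum => i; have [it|_] := boolP (1 <= i <= t)%N; last exact: measurable_cst.
  exact: mf.
by apply/funext => w; apply: eq_big_nat => i; rewrite ltnS => ->.
Qed.

Lemma price_events_measurable t : events t `<=` measurable.
Proof.
move=> A [i _ [Y mY <-]].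
by apply: measurable_price_steps.
Qed.

Lemma measurable_price t i : (i <= t)%N -> t.-measurable_fun (S i).
Proof.
move=> it _ Y mY; apply: sub_sigma_algebra; exists i => //.
by exists Y.
Qed.

Lemma measurable_running_max t i : (i <= t)%N -> t.-measurable_fun (M i).
Proof.
elim: i => [|i IH] it.
  rewrite (_ : M 0 = fun w => Num.max (S 0 w) m0).
    by apply: measurable_maxr; [exact: measurable_price|exact: measurable_cst].
  by apply/funext => w; rewrite /running_max big_nat1_id.
rewrite (_ : M i.+1 = fun w => Num.max (M i w) (S i.+1 w)).
  by apply: measurable_maxr; [exact: IH (ltnW it)|exact: measurable_price].
by apply/funext => w; rewrite running_maxS.
Qed.

Lemma measurable_max_ratio t i : (i <= t)%N -> t.-measurable_fun (X i).
Proof.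
move=> it; rewrite (_ : X i = fun w => M i w * S i w `^ (-1)).
  apply: measurable_funM; first exact: measurable_running_max.
  exact: measurableT_comp (measurable_powR _) (measurable_price _ _ it).
by apply/funext => w; rewrite powR_inv1// ltW// price_gt0.
Qed.

Lemma measurable_fun_later {d'} {U : measurableType d'} t u (f : T -> U) :
  (t <= u)%N -> t.-measurable_fun f -> u.-measurable_fun f.
Proof.
move=> tu mf _ Y mY; apply: (@natural_filtration_homo _ _ lam s0 epsf _ _ tu).
exact: mf.
Qed.

Lemma measurable_fun_events {d'} {U : measurableType d'} t (f : T -> U) :
  t.-measurable_fun f -> measurable_fun setT f.
Proof. by apply: measurable_fun_sub_sigma; apply: price_events_measurable. Qed.

(** Cylinders in the first t steps: the pi-system to which mutual independence applies directly,
    generating a sigma-algebra that contains the price events. *)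
Definition step_events (t : nat) : set (set T) :=
  [set A | exists B : nat -> set R, (forall i, measurable (B i)) /\
     A = \bigcap_(i in [set` iota 1 t]) eps i @^-1` B i].

Lemma step_events_setT t : step_events t setT.
Proof.
exists (fun=> setT); split => //; apply/seteqP; split => // w _ i _ //.
Qed.

Lemma step_events_setI t : setI_closed (step_events t).
Proof.
move=> _ _ [A [mA ->]] [B [mB ->]]; exists (fun i => A i `&` B i); split.
  by move=> i; apply: measurableI.
apply/seteqP; split => w /=.
  by move=> [Aw Bw] i it; split; [exact: Aw|exact: Bw].
by move=> ABw; split => i it; have [] := ABw i it.
Qed.

Lemma step_events_measurable t : step_events t `<=` measurable.
Proof.
move=> _ [B [mB ->]]; apply: bigcap_measurableType => i _.
exact: measurable_funPTI.
Qed.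

Lemma price_events_step t : <<s events t >> `<=` <<s step_events t >>.
Proof.
apply: smallest_sub; first exact: smallest_sigma_algebra.
move=> A [i /= it [Y mY <-]].
apply: (@measurable_price_steps _ (g_sigma_algebraType (step_events t)) epsf) => // j jm _ Z mZ.
apply: sub_sigma_algebra; exists (fun k => if k == j then Z else setT); split.
  by move=> k; case: ifP.
rewrite setTI; apply/seteqP; split => w /=.
  by move=> Zw k _; case: eqP => [->|].
move=> /(_ j); rewrite /= eqxx; apply; rewrite mem_iota; lia.
Qed.

(** The measures A -> P(A [&] E) and P(E) P agree on cylinders, hence on the sigma-algebra they
    generate. *)
Lemma step_independent N t A C : mutually_independent P [set i | (1 <= i <= N)%N] epsf ->
  (t < N)%N -> measurable C -> <<s events t >> A ->
  (P (A `&` eps t.+1 @^-1` C) = P A * P (eps t.+1 @^-1` C))%E.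
Proof.
move=> indep tN mC /price_events_step; set E := eps t.+1 @^-1` C => AG.
have mE : measurable E by exact: measurable_funPTI.
have k0 : 0 <= fine (P E) by rewrite fine_ge0.
have PEE : P E = (fine (P E))%:E by rewrite fineK// fin_num_measure.
transitivity (mrestr P mE A) => //.
transitivity (mscale (NngNum k0) P A); last by rewrite /mscale /= -PEE muleC.
apply: (@g_sigma_algebra_measure_unique _ R T (step_events t)
  (@step_events_measurable t) (fun=> setT) (fun=> step_events_setT t)) AG.
- by rewrite bigcup_const.
- exact: step_events_setI.
- move=> _ [B [mB ->]].
  (* Intersecting with E turns a cylinder in t steps into one in t + 1 steps, with C as the new
     coordinate. *)
  pose B' i := if i == t.+1 then C else B i.
  have mB' i : measurable (B' i) by rewrite /B'; case: ifP.
  have BE i : i \in iota 1 t -> B' i = B i.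
    by rewrite mem_iota /B'; case: eqP => // ->; lia.
  have it1 : iota 1 t.+1 = rcons (iota 1 t) t.+1.
    by rewrite -[t.+1 in LHS]addn1 iotaD cats1 add1n.
  set A0 := \bigcap_(i in _) _.
  transitivity (P (A0 `&` E)) => //.
  transitivity ((fine (P E))%:E * P A0)%E => //.
  rewrite -PEE {}/A0.
  have -> : \bigcap_(i in [set` iota 1 t]) eps i @^-1` B i `&` E =
      \bigcap_(i in [set` iota 1 t.+1]) eps i @^-1` B' i.
    rewrite it1; apply/seteqP; split => w /=.
      move=> [Bw Ew] i; rewrite /= mem_rcons inE => /orP[/eqP->|it].
        by rewrite /B' eqxx.
      by rewrite BE//; apply: Bw.
    move=> B'w; split => [i it|].
      by rewrite /= -BE//; apply: B'w; rewrite /= mem_rcons inE it orbT.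
    have := B'w t.+1; rewrite /= /B' eqxx; apply.
    by rewrite mem_rcons inE eqxx.
  have iotaN n : (n <= N)%N -> [set` iota 1 n] `<=` [set i | (1 <= i <= N)%N].
    by move=> nN i /=; rewrite mem_iota; lia.
  rewrite indep ?iota_uniq//; last exact: iotaN.
  rewrite indep ?iota_uniq//; last by apply: iotaN; apply: ltnW.
  have BC : B' t.+1 = C by rewrite /B' eqxx.
  rewrite it1 -cats1 big_cat big_seq1 BC muleC; congr (_ * _)%E.
  by apply: eq_big_seq => i it; rewrite BE.
- by move=> _; change (P (setT `&` E) < +oo)%E; rewrite setTI PEE ltry.
Qed.

End Measurability.

End Model.

(** * Survival probabilities *)

Section RandomMaturity.
Context {d : measure_display} {T : measurableType d} {R : realType}.
Context {P : probability T R} (N : nat) (Ntil : {RV P >-> nat}).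
Local Notation surv := (survival_prob P N Ntil).

Definition alive (t : nat) : set T := [set w | (t <= Ntil w)%N].

Definition alive_prob t : R := fine (P (alive t)).

Lemma measurable_alive t : measurable (alive t).
Proof. by rewrite -[alive t]/(Ntil @^-1` [set n | (t <= n)%N]); apply: measurable_funPTI. Qed.

Lemma alive_probE t : P (alive t) = (alive_prob t)%:E.
Proof. by rewrite fineK// fin_num_measure//; apply: measurable_alive. Qed.

Hypothesis Ntil_N : (0 < P [set w | Ntil w = N])%E.

(** Positive mass at N keeps the denominators of the conditional probabilities nonzero up to the
    horizon. *)
Lemma alive_prob_gt0 t : (t <= N)%N -> 0 < alive_prob t.
Proof.
move=> tN; rewrite -lte_fin -alive_probE; apply: lt_le_trans Ntil_N _.
apply: le_measure; rewrite ?inE; last by move=> w /= Nw; rewrite /alive /= Nw.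
- by rewrite -[X in measurable X]/(Ntil @^-1` [set N]); apply: measurable_funPTI.
- exact: measurable_alive.
Qed.

Lemma le_alive_prob t u : (t <= u)%N -> alive_prob u <= alive_prob t.
Proof.
move=> tu; rewrite -lee_fin -!alive_probE; apply: le_measure; rewrite ?inE.
- exact: measurable_alive.
- exact: measurable_alive.
- by move=> w /=; apply: leq_trans.
Qed.

Lemma survival_probE k : (k < N)%N ->
  surv k = alive_prob (N - k) / alive_prob (N - k.+1).
Proof.
move=> kN; rewrite /survival_prob /cond_prob setIidl// => w /=.
by apply: leq_trans; lia.
Qed.

Lemma survival_prob01 k : (k < N)%N -> 0 <= surv k <= 1.
Proof.
move=> kN; rewrite survival_probE//.
have Gk : 0 < alive_prob (N - k.+1) by apply: alive_prob_gt0; apply: leq_subr.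
apply/andP; split.
  by apply: divr_ge0; apply: ltW => //; apply: alive_prob_gt0; apply: leq_subr.
rewrite ler_pdivrMr// mul1r.
by apply: le_alive_prob; apply: leq_sub2l.
Qed.

(** The pi's are indexed by periods to the horizon: at time t the operator with index N - t is
    applied, and it uses pi_(N-t-1). *)
Lemma survival_alive t : (t < N)%N ->
  alive_prob t * surv (N - t.+1) = alive_prob t.+1.
Proof.
move=> tN; rewrite survival_probE; last lia.
have -> : (N - (N - t.+1))%N = t.+1 by lia.
have -> : (N - (N - t.+1).+1)%N = t by lia.
by rewrite mulrC divfK// gt_eqF// alive_prob_gt0// ltnW.
Qed.

End RandomMaturity.

(** The hypothesis is additive rather than a bound by differences, since the terms are extended
    reals. *)
Lemma telescoping_le {R : realDomainType} (e a : nat -> \bar R) n :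
  (forall t, (t < n)%N -> e t + a t.+1 <= a t)%E ->
  (\sum_(t < n) e t + a n <= a 0%N)%E.
Proof.
elim: n => [|n IH] ea; first by rewrite big_ord0 add0e.
rewrite big_ord_recr/= -addeA; apply: le_trans (IH _); last first.
  by move=> t tn; apply: ea; apply: ltnW.
by apply: leeD2l; apply: ea.
Qed.

Lemma telescoping_eq {R : realDomainType} (e a : nat -> \bar R) n :
  (forall t, (t < n)%N -> e t + a t.+1 = a t)%E ->
  (\sum_(t < n) e t + a n = a 0%N)%E.
Proof.
elim: n => [|n IH] ea; first by rewrite big_ord0 add0e.
rewrite big_ord_recr/= -addeA ea// IH// => t tn.
by apply: ea; apply: ltnW.
Qed.

(** * One-step transition of the weighted value *)

Section OptimalStopping.
Context {d : measure_display} {T : measurableType d} {R : realType}.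
Context {P : probability T R} {eps : nat -> {RV P >-> R}}.
Local Notation epsf := (fun i => eps i : T -> R).
Variables (r lam s0 m0 : R) (N : nat).
Hypotheses (r_gt0 : 0 < r) (lam_gt1 : 1 < lam).
Hypotheses (lamVr : lam^-1 < 1 + r) (r_lam : 1 + r < lam).
Hypotheses (s0_gt0 : 0 < s0) (s0_m0 : s0 <= m0).
Hypothesis eps_law : forall i, (1 <= i <= N)%N ->
     P (eps i @^-1` [set 1]) = (up_prob r lam)%:E /\
     P (eps i @^-1` [set -1]) = (down_prob r lam)%:E.
Hypothesis eps_indep : mutually_independent P [set i | (1 <= i <= N)%N] epsf.
Local Notation S := (price lam s0 epsf).
Local Notation M := (running_max lam s0 m0 epsf).
Local Notation X := (max_ratio lam s0 m0 epsf).
Local Notation events := (price_events lam s0 epsf).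
Local Notation "t .-measurable_fun" :=
  (measurable_fun (setT : set (g_sigma_algebraType (events t)))) (at level 2).

Let lam0 : 0 < lam. Proof. exact: lam_gt0. Qed.

Let one_neqN1 : (1 : R) <> -1. Proof. by lra. Qed.

(** The law is prescribed only through the masses at 1 and -1; these sum to 1, so all other values
    are negligible. *)
Lemma step_up_down t : (t < N)%N ->
  P (~` (eps t.+1 @^-1` [set 1] `|` eps t.+1 @^-1` [set -1])) = 0%E.
Proof.
move=> tN; have [|Pu Pd] := eps_law t.+1; first by rewrite tN.
have mu : measurable (eps t.+1 @^-1` [set 1]) by exact: measurable_funPTI.
have md : measurable (eps t.+1 @^-1` [set -1]) by exact: measurable_funPTI.
rewrite probability_setC; last exact: measurableU.
rewrite measureU//; last first.
  apply/seteqP; split => // w [/= -> e1].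
  by apply: one_neqN1.
transitivity (1 - ((up_prob r lam)%:E + (down_prob r lam)%:E))%E.
  by rewrite -Pu -Pd.
rewrite -EFinD.
by rewrite /down_prob addrC subrK subrr.
Qed.

Lemma integral_step t (f : T -> R) : (t < N)%N -> measurable_fun setT f ->
  (forall w, 0 <= f w) ->
  (\int[P]_w (f w)%:E = \int[P]_(w in eps t.+1 @^-1` [set 1%R]) (f w)%:E +
     \int[P]_(w in eps t.+1 @^-1` [set (-1)%R]) (f w)%:E)%E.
Proof.
move=> tN mf f0.
have mu : measurable (eps t.+1 @^-1` [set 1]) by exact: measurable_funPTI.
have md : measurable (eps t.+1 @^-1` [set -1]) by exact: measurable_funPTI.
have mud := measurableU _ _ mu md.
have mfE : measurable_fun setT (EFin \o f) by exact/measurable_EFinP.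
rewrite (@ge0_negligible_integral _ _ _ P setT _ _ (measurableC mud))//; last 2 first.
- by move=> w _; rewrite lee_fin.
- exact: step_up_down.
rewrite setTD setCK ge0_integral_setU//.
- exact: measurable_funTS.
- by move=> w _; rewrite lee_fin.
- rewrite disj_set2E; apply/eqP/seteqP; split => // w [/= -> e1].
  by apply: one_neqN1.
Qed.

(* Under the tilted probabilities the discounted price is the density that
   turns [Bop] into the one-step transition operator of the ratio. *)
Lemma one_step t (k : T -> nat) (phi : nat -> R -> R) : (t < N)%N ->
  t.-measurable_fun k -> (forall n, measurable_fun setT (phi n)) ->
  (forall n x, 1 <= x -> 0 <= phi n x) ->
  ((discount r)%:E * \int[P]_w (S t.+1 w * phi (k w) (X t.+1 w))%:E =
   \int[P]_w (S t w * Bop r lam (phi (k w)) (X t w))%:E)%E.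
Proof.
move=> tN mk mphi phi0.
have X1 i w : 1 <= X i w by exact: max_ratio_ge1.
have S0 i w : 0 < S i w by exact: price_gt0.
(* The integrand at t + 1 on the up and down events, expressed through quantities known at t so that
   independence of the next step applies. *)
pose fu w := lam * (S t w * phi (k w) (Num.max (lam^-1 * X t w) 1)).
pose fd w := lam^-1 * (S t w * phi (k w) (lam * X t w)).
have fu0 w : 0 <= fu w.
  apply: mulr_ge0; first exact: ltW.
  apply: mulr_ge0; first exact: ltW.
  by apply: phi0; rewrite le_max lexx orbT.
have fd0 w : 0 <= fd w.
  apply: mulr_ge0; first by rewrite invr_ge0 ltW.
  apply: mulr_ge0; first exact: ltW.
  by apply: phi0; apply: lam_ge1M.
have mfu : t.-measurable_fun fu.
  apply: measurable_funM; first exact: measurable_cst.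
  apply: measurable_funM; first exact: measurable_price.
  apply: (measurable_fun_indexed _ (fun n x => phi n (Num.max (lam^-1 * x) 1))) => //.
    move=> n; apply: (measurableT_comp (mphi n)); exact: measurable_maxr.
  exact: measurable_max_ratio.
have mfd : t.-measurable_fun fd.
  apply: measurable_funM; first exact: measurable_cst.
  apply: measurable_funM; first exact: measurable_price.
  apply: (measurable_fun_indexed _ (fun n x => phi n (lam * x))) => //.
    by move=> n; apply: (measurableT_comp (mphi n)); exact: mulrl_measurable.
  exact: measurable_max_ratio.
have mT (f : T -> R) : t.-measurable_fun f ->
  measurable_fun setT f by exact: measurable_fun_events.
have alpha0 : 0 <= discount r by rewrite ltW// discount_gt0.
rewrite (integral_step t)//; last first.
- by move=> w; rewrite mulr_ge0 ?phi0 ?(ltW (S0 _ _)).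
- apply: measurable_funM.
    by apply: (measurable_fun_events lam s0 t.+1); exact: measurable_price.
  apply: (measurable_fun_indexed _ phi) => //; first exact: measurable_fun_events mk.
  by apply: (measurable_fun_events lam s0 t.+1); exact: measurable_max_ratio.
have [|Pu Pd] := eps_law t.+1; first by rewrite tN.
have indep C : measurable C -> forall A, <<s events t >> A ->
  (P (A `&` eps t.+1 @^-1` C) = P A * P (eps t.+1 @^-1` C))%E.
  by move=> mC A; apply: step_independent eps_indep _ _.
rewrite (eq_integral (fun w => (fu w)%:E)); last first.
  move=> w; rewrite inE /= => e1; rewrite priceS//.
  rewrite (_ : X t.+1 w = Num.max (lam^-1 * X t w) 1); last exact: max_ratioS_up.
  by rewrite e1 powRr1 ?(ltW lam0)// (mulrC (S t w)) -mulrA.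
rewrite [X in (_ * (_ + X))%E](eq_integral (fun w => (fd w)%:E)); last first.
  move=> w; rewrite inE /= => e1; rewrite priceS//.
  rewrite (_ : X t.+1 w = lam * X t w); last exact: max_ratioS_down.
  by rewrite e1 powR_inv1 ?(ltW lam0)// (mulrC (S t w)) -mulrA.
have II (f : T -> R) (C : set R) : measurable C -> t.-measurable_fun f -> (forall w, 0 <= f w) ->
  (\int[P]_(w in eps t.+1 @^-1` C) (f w)%:E =
   P (eps t.+1 @^-1` C) * \int[P]_w (f w)%:E)%E.
  move=> mC mf f0; apply: integral_independent mf f0; last exact: indep.
    exact: price_events_measurable.
  exact: measurable_funPTI.
rewrite !II//.
rewrite Pu Pd.
have p0 : 0 <= up_prob r lam by rewrite ltW// up_prob_gt0.
have q0 : 0 <= down_prob r lam by rewrite ltW// down_prob_gt0.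
have mE (f : T -> R) : t.-measurable_fun f -> measurable_fun setT (EFin \o f).
  by move=> /mT mf; apply/measurable_EFinP.
have fE f : (forall w, 0 <= f w) -> forall w : T, setT w -> (0 <= (f w)%:E)%E.
  by move=> f0 w _; rewrite lee_fin.
have If0 f : (forall w, 0 <= f w) -> (0 <= \int[P]_w (f w)%:E)%E.
  by move=> f0; apply: integral_ge0 => w _; rewrite lee_fin.
(* Combined with the factors lam and lam^-1 in [fu] and [fd], these become the tilted
   probabilities. *)
pose au := discount r * up_prob r lam; pose ad := discount r * down_prob r lam.
have au0 : 0 <= au by apply: mulr_ge0.
have ad0 : 0 <= ad by apply: mulr_ge0.
have mZ a (f : T -> R) : t.-measurable_fun f -> measurable_fun setT (fun w => (a%:E * (f w)%:E)%E).
  by move=> mf; apply: (mE (fun w => a * f w)); apply: measurable_funM.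
transitivity (\int[P]_w (au%:E * (fu w)%:E + ad%:E * (fd w)%:E))%E; last first.
  apply: eq_integral => w _; rewrite -!EFinM -EFinD; congr (_%:E).
  by rewrite /fu /fd /Bop /au /ad /tilted_up_prob /tilted_down_prob; ring.
rewrite ge0_integralD//; [|by move=> w _; rewrite mule_ge0 ?lee_fin|exact: mZ
  |by move=> w _; rewrite mule_ge0 ?lee_fin|exact: mZ].
rewrite !ge0_integralZl ?lee_fin//; [|exact: mE|exact: fE|exact: mE|exact: fE].
by rewrite ge0_muleDr ?mule_ge0 ?lee_fin ?If0// !muleA -!EFinM.
Qed.


Variables (Ntil : {RV P >-> nat}).
Hypothesis Ntil_indep : independent_systems P
  (natural_filtration S N) (preimage_set_system [set: T] (Ntil : T -> nat) measurable).
Hypothesis Ntil_N : (0 < P [set w | Ntil w = N])%E.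
Local Notation surv := (survival_prob P N Ntil).
Local Notation alpha := (discount r).
Local Notation alive := (alive Ntil).
Local Notation alive_prob := (alive_prob Ntil).


Let w_ge0 t : (t <= N)%N -> 0 <= alpha ^+ t * alive_prob t.
Proof.
move=> tN; rewrite mulr_ge0 ?exprn_ge0 ?(ltW (discount_gt0 r_gt0))//.
by rewrite ltW// (alive_prob_gt0 N Ntil Ntil_N).
Qed.

Let S_ge0 t w : 0 <= S t w. Proof. by rewrite ltW// price_gt0. Qed.
Let X_ge1 t w : 1 <= X t w. Proof. exact: max_ratio_ge1. Qed.
Let X_ge0 t w : 0 <= X t w. Proof. exact: le_trans (X_ge1 t w). Qed.

(** The factor pi of the operator turns [alive_prob t] into [alive_prob t.+1], and [one_step]
    absorbs one discount factor and the change of price. The index k stands for the rights kept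
    after the decision at t. *)
Lemma continuation_transition t (k : T -> nat) : (t < N)%N -> t.-measurable_fun k ->
  (\int[P]_w (alpha ^+ t * alive_prob t *
      (S t w * continuation (r := r) (lam := lam) (surv := surv) (k w) (N - t) (X t w)))%:E =
   \int[P]_w (alpha ^+ t.+1 * alive_prob t.+1 *
      (S t.+1 w * value r lam surv (k w) (N - t.+1) (X t.+1 w)))%:E)%E.
Proof.
move=> tN mk.
have v0 n x : 1 <= x -> 0 <= value r lam surv n (N - t.+1) x.
  by apply: (value_ge0 r_gt0 lam_gt1 lamVr r_lam N (survival_prob01 N Ntil Ntil_N)); lia.
have mv n : measurable_fun setT (value r lam surv n (N - t.+1)).
  exact: measurable_value.
have Pos := w_ge0 t.+1 tN.
have mST i : (i <= N)%N -> measurable_fun setT (S i).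
  by move=> iN; apply: (measurable_fun_events lam s0 i); apply: measurable_price.
have mXT i : (i <= N)%N -> measurable_fun setT (X i).
  by move=> iN; apply: (measurable_fun_events lam s0 i); apply: measurable_max_ratio.
have mkT : measurable_fun setT k by exact: measurable_fun_events mk.
have a0 : 0 <= alpha by rewrite ltW// discount_gt0.
rewrite [RHS](eq_integral (fun w => (alpha ^+ t * alive_prob t.+1)%:E *
   (alpha%:E * (S t.+1 w * value r lam surv (k w) (N - t.+1) (X t.+1 w))%:E))%E); last first.
  by move=> w _; rewrite -!EFinM exprS; congr (_%:E); ring.
rewrite [LHS](eq_integral (fun w => (alpha ^+ t * alive_prob t.+1)%:E *
   (S t w * Bop r lam (value r lam surv (k w) (N - t.+1)) (X t w))%:E)%E); last first.
  move=> w _; rewrite -!EFinM -(survival_alive N Ntil Ntil_N)// /continuation.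
  by rewrite -(subnSK tN) /Bop_at /=; congr (_%:E); ring.
have c0 : (0 <= (alpha ^+ t * alive_prob t.+1)%:E)%E.
  by rewrite lee_fin mulr_ge0 ?exprn_ge0// ltW// (alive_prob_gt0 N Ntil Ntil_N).
have m1 : measurable_fun setT (fun w =>
    (S t.+1 w * value r lam surv (k w) (N - t.+1) (X t.+1 w))%:E).
  apply/measurable_EFinP; apply: measurable_funM; first exact: mST.
  by apply: (measurable_fun_indexed _ (fun n => value r lam surv n (N - t.+1))) => //; apply: mXT.
rewrite [RHS]ge0_integralZl//; last 2 first.
- by apply: emeasurable_funM => //; apply: measurable_cst.
- move=> w _; rewrite -EFinM lee_fin; apply: mulr_ge0 => //.
  by apply: mulr_ge0 => //; apply: v0.
rewrite [X in _ = (_ * X)%E]ge0_integralZl//; last first.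
  by move=> w _; rewrite lee_fin; apply: mulr_ge0 => //; apply: v0.
rewrite (one_step t k (fun n => value r lam surv n (N - t.+1)))//.
rewrite ge0_integralZl//.
- apply/measurable_EFinP; apply: measurable_funM; first by apply: mST; exact: ltnW.
  apply: (measurable_fun_indexed _ (fun n => Bop r lam (value r lam surv n (N - t.+1)))) => //.
    by move=> n; apply: measurable_Bop.
  by apply: mXT; exact: ltnW.
- move=> w _; rewrite lee_fin; apply: mulr_ge0 => //.
  have tp := tilted_up_prob_gt0 r_gt0 lam_gt1 lamVr r_lam.
  have tq := tilted_down_prob_gt0 r_gt0 lam_gt1 lamVr r_lam.
  apply: addr_ge0; apply: mulr_ge0; try exact: ltW; apply: v0.
    by rewrite le_max lexx orbT.
  exact: lam_ge1M.
Qed.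

Let mS i : measurable_fun setT (S i).
Proof. by apply: (measurable_fun_events lam s0 i); apply: measurable_price. Qed.
Let mX i : measurable_fun setT (X i).
Proof. by apply: (measurable_fun_events lam s0 i); apply: measurable_max_ratio. Qed.

(** * Expected payoff of an arbitrary admissible schedule *)

Section Schedule.
Variables (m : nat) (sigma : nat -> T -> option 'I_N.+1).
Hypothesis sigma_adm : admissible (natural_filtration S) m sigma.

Local Notation left_at t := (fun w => remaining m (sigma^~ w) t).
Local Notation used_at t := (fun w => exercises m (sigma^~ w) t).

Lemma used_at_le1 t w : (exercises m (sigma^~ w) t <= 1)%N.
Proof.
have [_ /(_ w)[l _ [_ dec]]] := sigma_adm.
apply: exercises_le1 => i j u v i1 ij jm; exact: dec.
Qed.

(** Used before t + 1 means used by t, which is an event of the stopping time at t. *)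
Lemma measurable_left_atS t : (t <= N)%N -> t.-measurable_fun (left_at t.+1).
Proof.
move=> tN; have [st _] := sigma_adm.
rewrite (_ : left_at _ = fun w =>
    (\sum_(i <- index_iota 1 m.+1 | 0 < i <= m) ~~ before (sigma i w) t.+1)%N).
  apply: measurable_fun_sumn => i im.
  have mb : t.-measurable_fun (fun w => ~~ before (sigma i w) t.+1).
    apply: measurable_neg; apply: (measurable_fun_bool true); rewrite setTI.
    rewrite (_ : _ @^-1` _ =
      [set w | if sigma i w is Some u then (u <= t)%N else false]).
      exact: st.
    by apply/seteqP; split => w /=; case: (sigma i w).
  by apply: (measurableT_comp (f := nat_of_bool)) mb.
apply/funext => w; rewrite /remaining big_nat; apply: eq_bigl => i.
by rewrite ltnS.
Qed.

Lemma measurable_left_at t : (t <= N.+1)%N -> measurable_fun setT (left_at t).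
Proof.
case: t => [_|t tN].
  rewrite (_ : left_at 0%N = cst m); first exact: measurable_cst.
  by apply/funext => w; apply: remaining0.
by apply: (measurable_fun_events lam s0 t); apply: measurable_left_atS.
Qed.

(** Measurability at N is enough, since maturity is independent of all prices up to N. *)
Lemma measurable_used_at t : (t <= N)%N -> N.-measurable_fun (used_at t).
Proof.
move=> tN; rewrite (_ : used_at t =
    fun w => (remaining m (sigma^~ w) t - remaining m (sigma^~ w) t.+1)%N).
  apply: measurable_fun_subn.
    case: t tN => [_|t tN]; last first.
      apply: (measurable_fun_later lam s0 _ _ _ (ltnW tN)).
      by apply: measurable_left_atS; apply: ltnW.
    rewrite (_ : left_at 0%N = cst m); first exact: measurable_cst.
    by apply/funext => w; apply: remaining0.
  exact: (measurable_fun_later lam s0 _ _ _ tN (measurable_left_atS _ tN)).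
by apply/funext => w; rewrite (remainingE m _ t) addnK.
Qed.

Definition exercise_gain t : \bar R := (\int[P]_w (alpha ^+ t * alive_prob t *
  (S t w * (X t w * (exercises m (sigma^~ w) t)%:R)))%:E)%E.

(** Without the cutoff, truncated subtraction at t = N + 1 would give zero periods to go, where a
    remaining right is still worth x. *)
Definition remaining_value t : \bar R := if (t <= N)%N then
  (\int[P]_w (alpha ^+ t * alive_prob t *
     (S t w * value r lam surv (remaining m (sigma^~ w) t) (N - t) (X t w)))%:E)%E
  else 0%E.

Let a_ge0 : 0 <= alpha. Proof. by rewrite ltW// discount_gt0. Qed.

Let cont t w : R := continuation (r := r) (lam := lam) (surv := surv)
  (remaining m (sigma^~ w) t.+1) (N - t) (X t w).

Lemma remaining_valueS t : (t <= N)%N ->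
  remaining_value t.+1 =
  (\int[P]_w (alpha ^+ t * alive_prob t * (S t w * cont t w))%:E)%E.
Proof.
rewrite /remaining_value /cont leq_eqVlt => /orP[/eqP->|tN].
  rewrite ltnn (eq_integral (cst 0%E)) ?integral0// => w _.
  by rewrite subnn /= !mulr0.
by rewrite tN -continuation_transition//; apply: measurable_left_atS; exact: ltnW.
Qed.

(** The gain at t is a function of prices integrated over [alive t] only, and independence of
    maturity turns this restriction into the factor P(t <= Ntil). *)
Lemma total_payoff_expectation :
  ('E_P[total_payoff alpha Ntil M m sigma] = \sum_(t < N.+1) exercise_gain t)%E.
Proof.
have tleN (t : 'I_N.+1) : (t <= N)%N by rewrite -ltnS.
have M_ge0 t w : 0 <= M t w by rewrite -(price_max_ratio lam s0 m0 epsf lam0 s0_gt0) mulr_ge0.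
have mg (t : 'I_N.+1) : N.-measurable_fun
    (fun w => alpha ^+ t * M t w * (exercises m (sigma^~ w) t)%:R).
  apply: measurable_funM.
    by apply: measurable_funM; [exact: measurable_cst|exact: measurable_running_max].
  apply: (measurable_fun_indexed _ (fun n (_ : R) => n%:R)) (measurable_cst (0 : R)).
    exact: measurable_used_at.
  by move=> n; apply: measurable_cst.
have g0 (t : 'I_N.+1) w : 0 <= alpha ^+ t * M t w * (exercises m (sigma^~ w) t)%:R.
  by rewrite !mulr_ge0// exprn_ge0.
pose f (t : 'I_N.+1) w := (alpha ^+ t * M t w * (exercises m (sigma^~ w) t)%:R)%:E.
have fE (t : 'I_N.+1) : f t \_ (alive t) = fun w =>
    (alpha ^+ t * (t <= Ntil w)%:R * M t w * (exercises m (sigma^~ w) t)%:R)%:E.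
  apply/funext => w; rewrite patchE (_ : (w \in alive t) = (t <= Ntil w)%N); last first.
    by apply/idP/idP; rewrite inE.
  by case: (t <= Ntil w)%N; rewrite /f ?mulr1// mulr0 !mul0r.
have mfE (t : 'I_N.+1) : measurable_fun setT (f t).
  by apply/measurable_EFinP; apply: (measurable_fun_events lam s0 N).
rewrite unlock; transitivity (\int[P]_w (\sum_(t < N.+1) (f t \_ (alive t)) w))%E.
  apply: eq_integral => w _; rewrite total_payoffE -sumEFin.
  by apply: eq_bigr => t _; rewrite fE.
rewrite ge0_integral_sum//; last 2 first.
- move=> t; apply/(measurable_restrictT _ (measurable_alive Ntil t)).
  exact: measurable_funTS.
- by move=> t w _; rewrite fE lee_fin !mulr_ge0// exprn_ge0.
apply: eq_bigr => t _; rewrite -integral_mkcond.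
have ev_meas : price_events lam s0 epsf N `<=` measurable by exact: price_events_measurable.
have indep A : <<s price_events lam s0 epsf N >> A ->
    (P (A `&` alive t) = P A * P (alive t))%E.
  move=> AN; apply: Ntil_indep => //.
  by exists [set n | (t <= n)%N] => //; rewrite setTI.
rewrite (integral_independent P _ _ _ ev_meas (measurable_alive Ntil t) indep (mg t) (g0 t)).
rewrite alive_probE -ge0_integralZl//; last 3 first.
- exact: mfE.
- by move=> w _; rewrite lee_fin g0.
- by rewrite lee_fin ltW// (alive_prob_gt0 N Ntil Ntil_N).
apply: eq_integral => w _; rewrite -EFinM; congr (_%:E).
by rewrite -(price_max_ratio lam s0 m0 epsf lam0 s0_gt0); ring.
Qed.

Let gain_ge0 t w : (t <= N)%N -> 0 <= alpha ^+ t * alive_prob t *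
  (S t w * (X t w * (exercises m (sigma^~ w) t)%:R)).
Proof.
move=> tN; apply: mulr_ge0; first exact: w_ge0.
by apply: mulr_ge0 => //; apply: mulr_ge0.
Qed.

Let cont_ge0 t w : 0 <= cont t w.
Proof.
by apply: (continuation_ge0 r_gt0 lam_gt1 lamVr r_lam N (survival_prob01 N Ntil Ntil_N)); rewrite ?leq_subr.
Qed.

Let gainD t : (t <= N)%N -> (exercise_gain t + remaining_value t.+1 =
  \int[P]_w (alpha ^+ t * alive_prob t *
    (S t w * (X t w * (exercises m (sigma^~ w) t)%:R + cont t w)))%:E)%E.
Proof.
move=> tN; rewrite remaining_valueS// -ge0_integralD//.
- by apply: eq_integral => w _; rewrite -EFinD; congr (_%:E); ring.
- by move=> w _; rewrite lee_fin gain_ge0.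
- apply/measurable_EFinP; apply: measurable_funM; first exact: measurable_cst.
  apply: measurable_funM => //; apply: measurable_funM => //.
  apply: (measurable_fun_indexed _ (fun n (_ : R) => n%:R)) (measurable_cst (0 : R)).
    apply: (measurable_fun_events lam s0 N); exact: measurable_used_at.
  by move=> n; apply: measurable_cst.
- by move=> w _; rewrite lee_fin mulr_ge0 ?w_ge0// mulr_ge0.
- apply/measurable_EFinP; apply: measurable_funM; first exact: measurable_cst.
  apply: measurable_funM => //.
  apply: (measurable_fun_indexed _ (fun n => continuation n (N - t))) => //.
    by apply: measurable_left_at.
  by move=> n; apply: measurable_continuation.
Qed.

Lemma remaining_value0 : remaining_value 0 =
  (\int[P]_w (alpha ^+ 0 * alive_prob 0 *
     (S 0 w * value r lam surv m N (X 0 w)))%:E)%E.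
Proof. by apply: eq_integral => w _; rewrite remaining0 subn0. Qed.

Lemma remaining_valueN : remaining_value N.+1 = 0%E.
Proof. by rewrite /remaining_value ltnn. Qed.

Lemma expectation_le : ('E_P[total_payoff alpha Ntil M m sigma] <= remaining_value 0)%E.
Proof.
rewrite total_payoff_expectation.
have := telescoping_le exercise_gain remaining_value N.+1.
rewrite remaining_valueN adde0; apply => t tN; rewrite ltnS in tN.
rewrite gainD// /remaining_value tN; apply: ge0_le_integral => //.
- move=> w _; rewrite lee_fin; apply: mulr_ge0; first exact: w_ge0.
  by apply: mulr_ge0 => //; apply: addr_ge0 => //; apply: mulr_ge0.
- apply/measurable_EFinP; apply: measurable_funM; first exact: measurable_cst.
  apply: measurable_funM => //; apply: measurable_funD.
    apply: measurable_funM => //.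
    apply: (measurable_fun_indexed _ (fun n (_ : R) => n%:R)) (measurable_cst (0 : R)).
      apply: (measurable_fun_events lam s0 N); exact: measurable_used_at.
    by move=> n; apply: measurable_cst.
  apply: (measurable_fun_indexed _ (fun n => continuation n (N - t))) => //.
    by apply: measurable_left_at.
  by move=> n; apply: measurable_continuation.
- apply/measurable_EFinP; apply: measurable_funM; first exact: measurable_cst.
  apply: measurable_funM => //.
  apply: (measurable_fun_indexed _ (fun n => value r lam surv n (N - t))) => //.
    by apply: measurable_left_at; apply: leqW.
  by move=> n; apply: measurable_value.
(* The rights held at t split into the at most one used and those kept, as in [value_step]. *)
move=> w _; rewrite lee_fin ler_wpM2l ?w_ge0// ler_wpM2l// [in leRHS](remainingE m _ t).
by apply: value_step; rewrite ?used_at_le1.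
Qed.

Lemma expectation_eq :
  (forall t w, (t <= N)%N -> X t w * (exercises m (sigma^~ w) t)%:R + cont t w =
     value r lam surv (remaining m (sigma^~ w) t) (N - t) (X t w)) ->
  ('E_P[total_payoff alpha Ntil M m sigma] = remaining_value 0)%E.
Proof.
move=> opt; rewrite total_payoff_expectation.
have := telescoping_eq exercise_gain remaining_value N.+1.
rewrite remaining_valueN adde0; apply => t tN; rewrite ltnS in tN.
rewrite gainD// /remaining_value tN; apply: eq_integral => w _.
by rewrite opt.
Qed.

End Schedule.

(** * Admissibility and optimality of the threshold schedule *)

Section Threshold.
Variable m : nat.
Local Notation y := (boundary r lam surv).
Local Notation sigma := (threshold_schedule (N := N) y X m).

Lemma threshold_hit i t w : (0 < i)%N -> (t <= N)%N ->
  (y i (N - t) <= X t w) =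
  (marginal_continuation r lam surv i (N - t) (X t w) <= X t w).
Proof.
move=> i0 tN; have [_ E] := exercise_region_boundary r_gt0 lam_gt1 lamVr r_lam N
  (survival_prob01 N Ntil Ntil_N) i (N - t) i0 (leq_subr _ _).
have : exercise_region r lam surv i (N - t) (X t w) <-> y i (N - t) <= X t w by rewrite E.
move=> [E1 E2]; apply/idP/idP => [/E2[]//|h].
by apply: E1; split.
Qed.

(** Induction on time for all rights at once: right i is used by t + 1 iff it was used by t, or its
    threshold is reached at t + 1 with right i + 1 already used by t. At time 0 only right m can be
    used. *)
Lemma measurable_threshold_before i t : (0 < i <= m)%N -> (t <= N)%N ->
  t.-measurable_fun (fun w => before (sigma i w) t.+1).
Proof.
move=> + tN; elim: t tN i => [|t IH] tN i im.
  rewrite (_ : (fun w => _) = fun w => (i == m) && (y i (N - 0) <= X 0 w)).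
    apply: measurable_and; first exact: measurable_cst.
    by apply: measurable_fun_ler; [exact: measurable_cst|exact: measurable_max_ratio].
  apply/funext => w; have := threshold_at_time y X m w i (ord0 : 'I_N.+1) im.
  rewrite -[nat_of_ord ord0]/0%N.
  rewrite /= (_ : before (sigma i w) 0 = false) ?andbT; last by case: (sigma i w).
  rewrite (_ : at_time (sigma i w) 0 = before (sigma i w) 1); last first.
    by case: (sigma i w) => //= v; rewrite ltnS leqn0.
  by move=> ->; case: eqP => // _; case: (sigma i.+1 w).
have tN' := ltnW tN; pose u : 'I_N.+1 := Ordinal (tN : (t.+1 < N.+1)%N).
have mb j : (0 < j <= m)%N -> t.+1.-measurable_fun (fun w => before (sigma j w) t.+1).
  by move=> jm; apply: (measurable_fun_later lam s0 _ _ _ (leqnSn t)); apply: IH.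
have ma : t.+1.-measurable_fun (fun w => if i == m then true else before (sigma i.+1 w) t.+1).
  by case: eqP => [_|ne]; [exact: measurable_cst|apply: mb; move: im ne; lia].
rewrite (_ : (fun w => _) = fun w => ~~ (~~ before (sigma i w) t.+1 && ~~
   [&& (if i == m then true else before (sigma i.+1 w) t.+1),
       y i (N - t.+1) <= X t.+1 w & ~~ before (sigma i w) t.+1])).
  apply: measurable_neg; apply: measurable_and; first by apply: measurable_neg; apply: mb.
  apply: measurable_neg; apply: measurable_and => //.
  apply: measurable_and; last by apply: measurable_neg; apply: mb.
  by apply: measurable_fun_ler; [exact: measurable_cst|exact: measurable_max_ratio].
apply/funext => w; rewrite -(threshold_at_time y X m w i u im) /= negb_and !negbK.
by case: (sigma i w) => //= v; rewrite ltnS leq_eqVlt orbC.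
Qed.

Lemma threshold_admissible : admissible (natural_filtration S) m sigma.
Proof.
split.
  move=> i im t tN; have := measurable_threshold_before i t im tN measurableT [set true] I.
  rewrite setTI; congr (natural_filtration _ _ _).
  by apply/seteqP; split => w /=; case: (sigma i w).
move=> w; have [l lm someE] := threshold_finite (N := N) y X m w.
exists l => //; split=> // i j u v i0 ij jm; exact: threshold_ltn.
Qed.

Lemma threshold_expectation : (0 < m)%N ->
  ('E_P[total_payoff alpha Ntil M m sigma] = remaining_value m sigma 0)%E.
Proof.
move=> m0'; apply: expectation_eq; first exact: threshold_admissible.
move=> t w tN; rewrite [in RHS](remainingE m _ t).
apply: value_step_eq => //.
  exact: (@used_at_le1 m sigma threshold_admissible).
rewrite -remainingE => k0.
have := threshold_exercises y X m w (Ordinal (tN : (t < N.+1)%N)); rewrite /= k0 /= => ->.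
by rewrite threshold_hit.
Qed.

Lemma threshold_optimal : (0 < m)%N ->
  ('E_P[total_payoff alpha Ntil M m sigma] =
   ereal_sup [set 'E_P[total_payoff alpha Ntil M m sigma']
     | sigma' in [set sigma' : nat -> T -> option 'I_N.+1 |
                  admissible (natural_filtration S) m sigma']])%E.
Proof.
move=> m0'; apply/eqP; rewrite eq_le; apply/andP; split.
  by apply: ereal_sup_ubound; exists sigma => //; exact: threshold_admissible.
apply: ge_ereal_sup => _ [sigma' adm <-].
(* Every schedule starts with all m rights, so the initial value is common to both. *)
rewrite threshold_expectation// remaining_value0 -(remaining_value0 m sigma').
exact: expectation_le.
Qed.

End Threshold.

End OptimalStopping.

Theorem theorem5p7 (R : realType) (r lam s0 m0 : R) (N : nat)
  (d : measure_display) (T : measurableType d) (P : probability T R)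
  (eps : nat -> {RV P >-> R}) (Ntil : {RV P >-> nat}) :
  0 < r -> 1 < lam -> lam^-1 < 1 + r -> 1 + r < lam ->
  0 < s0 -> s0 <= m0 ->
  (forall i, (1 <= i <= N)%N ->
     P (eps i @^-1` [set 1]) = (up_prob r lam)%:E /\
     P (eps i @^-1` [set -1]) = (down_prob r lam)%:E) ->
  mutually_independent P [set i | (1 <= i <= N)%N] (fun i => eps i : T -> R) ->
  let S := price lam s0 (fun i => eps i : T -> R) in
  let M := running_max lam s0 m0 (fun i => eps i : T -> R) in
  let X := max_ratio lam s0 m0 (fun i => eps i : T -> R) in
  let F := natural_filtration S in
  (forall w, (Ntil w <= N)%N) ->
  independent_systems P
    (F N) (preimage_set_system [set: T] (Ntil : T -> nat) measurable) ->
  (0 < P [set w | Ntil w = N])%E ->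
  let alpha := discount r in
  let pi := survival_prob P N Ntil in
  let y := boundary r lam pi in
  [/\
   (* (i) *)
   forall m n, (1 <= m)%N -> (n <= N)%N ->
     has_inf (exercise_region r lam pi m n) /\
     exercise_region r lam pi m n = [set x | y m n <= x],
   (* (ii) *)
   forall m n, (1 <= m)%N -> (n <= N)%N -> y m.+1 n <= y m n,
   (* (iii) *)
   (forall k, (k.+1 < N)%N -> pi k <= pi k.+1) ->
     forall m, (1 <= m)%N ->
       y m 0%N = 1 /\ forall n, (n < N)%N -> y m n <= y m n.+1 &
   (* (iv) *)
   forall m, (1 <= m)%N ->
     let sigma_star : nat -> T -> option 'I_N.+1 := threshold_schedule y X m in
     [/\ admissible F m sigma_star,
         ('E_P[total_payoff alpha Ntil M m sigma_star])%E =
           ereal_sup [set ('E_P[total_payoff alpha Ntil M m sigma])%E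
                     | sigma in [set sigma : nat -> T -> option 'I_N.+1
                                | admissible F m sigma]],
         forall i w, (1 <= i <= m)%N ->
           right_payoff alpha Ntil M sigma_star i w != 0 ->
           exists2 t, sigma_star i w = Some t & (t <= Ntil w)%N &
         forall i w, (1 <= i <= m)%N ->
           (if sigma_star i w is Some t then (Ntil w < t)%N else true) ->
           forall j, (1 <= j <= i)%N ->
             right_payoff alpha Ntil M sigma_star j w = 0]].
Proof.
move=> r_gt0 lam_gt1 lamVr r_lam s0_gt0 s0_m0 eps_law eps_indep S M X F.
move=> Ntil_le Ntil_indep Ntil_N alpha pi y.
have pi01 : forall k, (k < N)%N -> 0 <= pi k <= 1 by exact: survival_prob01 Ntil_N.
split.
- by move=> m n m0' nN; apply: exercise_region_boundary nN.
- by move=> m n m0' nN; apply: boundaryS_le nN.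
- move=> pi_le m m0'; split; first exact: boundary0.
  by move=> n nN; apply: boundary_homo nN.
move=> m m0'; split.
- exact: threshold_admissible.
- exact: threshold_optimal.
- move=> i w _; rewrite /right_payoff; case: threshold_schedule => [t|]; last by rewrite eqxx.
  move=> nz; exists t => //; apply: contraNT nz => /negbTE ->.
  by rewrite mulr0 mul0r.
- move=> i w /andP[i0 im] dead j ji.
  exact: threshold_expired dead.
Qed.
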